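(* There exists an absolute constant $A>0$ such that for every separable Banach space $(\mathcal X,\|\cdot\|)$, every $f\in\mathcal M_{ind}(\mathcal X)$, every $p\ge2$, every $c$ with $1\le c\le p$, every non-random $x\in\mathcal X$ and every $n=1,2,\ldots$, $$\big\|\,\|f_n+x\|-\mathbf E\|f_n+x\|\,\big\|_p\le A\left(c\|d^*\|_p+\sqrt c\,e^{p/c}\|S_2\|_2\right);$$ in particular, $$\big\|\,\|f_n+x\|-\mathbf E\|f_n+x\|\,\big\|_p\le A\left(p\|d^*\|_p+\sqrt p\,\|S_2\|_2\right),$$ $$\big\|\,\|f_n+x\|-\mathbf E\|f_n+x\|\,\big\|_p\le A\,\frac p{\ln p}\left(\|d^*\|_p+\|S_2\|_2\right),$$ $$\big\|\,\|f_n+x\|-\mathbf E\|f_n+x\|\,\big\|_p\le A\left(\alpha\|d^*\|_p+e^{p/\alpha}\|S_2\|_2\right)\qquad\text{for all }\alpha\text{ with }1\le\alpha\le\frac p{\ln(ep)}.$$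
   Context: For a separable Banach space $\mathcal X$, $\mathcal M_{ind}(\mathcal X)$ is the class of all sequences $f=(f_0,f_1,\ldots)$ of Bochner-integrable random vectors in $\mathcal X$ (on some probability space, which may depend on $f$) with $f_0\equiv0$ whose increments $d_j=f_j-f_{j-1}$, $j=1,2,\ldots$, are independent (not necessarily of zero mean). Put $d_0=0$, $d^*=\sup_{j\ge0}\|d_j\|$, $S_2=\left(\sum_{j=1}^\infty\|d_j\|^2\right)^{1/2}$. For a real random variable $Y$, $\|Y\|_p=(\mathbf E|Y|^p)^{1/p}\in[0,\infty]$. *)

(* Defs.v *)
From mathcomp Require Import all_boot all_order all_algebra finmap.
From mathcomp Require Import all_classical all_reals all_analysis.

Set Implicit Arguments.
Unset Strict Implicit.
Unset Printing Implicit Defensive.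

Import Order.TTheory GRing.Theory Num.Theory.
Import numFieldNormedType.Exports.

Local Open Scope classical_set_scope.
Local Open Scope ring_scope.

Definition separable (X : topologicalType) : Prop :=
  exists2 D : set X, countable D & dense D.

Notation borel X := (g_sigma_algebraType (@open X)).

Section RandomVectors.
Context {R : realType} {X : completeNormedModType R}.
Context {d : measure_display} {T : measurableType d}.
Variable P : probability T R.

Definition random_vector (Y : T -> X) : Prop :=
  measurable_fun [set: T] (Y : T -> borel X).

Definition simple_vector (Y : T -> X) : Prop :=
  random_vector Y /\ finite_set (range Y).

Definition bochner_integrable (Y : T -> X) : Prop :=
  random_vector Y /\
  exists s : nat -> T -> X, (forall k, simple_vector (s k)) /\
    (fun k => \int[P]_w (`|Y w - s k w|)%:E)%E @ \oo --> 0%E.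

Definition independent_vectors (Y : nat -> T -> X) : Prop :=
  forall (J : {fset nat}) (B : nat -> set (borel X)),
    (forall j, measurable (B j)) ->
    P (\bigcap_(j in [set` J]) (Y j @^-1` B j)) =
    (\prod_(j <- J) P (Y j @^-1` B j))%E.

(* [increment f j] is d_j = f_j - f_(j-1), with the convention d_0 = 0. *)
Definition increment (f : nat -> T -> X) (j : nat) (w : T) : X :=
  if j is i.+1 then f i.+1 w - f i w else 0.

(* The shift to [j.+1] leaves d_0 out of the independent family. *)
Definition M_ind (f : nat -> T -> X) : Prop :=
  [/\ forall j, bochner_integrable (f j),
      forall w, f 0%N w = 0
    & independent_vectors (fun j => increment f j.+1)].

Local Open Scope ereal_scope.

Definition dstar (f : nat -> T -> X) (w : T) : \bar R :=
  ereal_sup [set (`|increment f j w|)%:E | j in [set: nat]].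

Definition S2 (f : nat -> T -> X) (w : T) : \bar R :=
  (\sum_(1 <= j <oo) (`|increment f j w| ^+ 2)%:E) `^ 2^-1.

(* ['E_P] is extended-real valued; it is finite here when [Y] is Bochner
   integrable, so the subtraction is the usual one. *)
Definition centered_norm (Y : T -> X) (w : T) : \bar R :=
  (`|Y w|)%:E - 'E_P[fun v => `|Y v|%R].

End RandomVectors.

(* Main.v *)
From HB Require Import structures.
Require Import Defs.
From mathcomp Require Import all_boot all_order all_algebra finmap.
From mathcomp Require Import all_classical all_reals all_analysis.
From mathcomp Require Import measurable_realfun ring lra.

(** Truncate the increments d_j at a level t just above twice the p-norm of d^*:
    write d_j = v_j + r_j, where v_j = d_j when |d_j| <= t and v_j = 0 otherwise.
    The two parts are treated by different means.

    Bounded part.  Let g be the 1-Lipschitz function y |-> |y + x| and S the sum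
    of the v_j.  Integrating out one increment at a time keeps g 1-Lipschitz, and
    each integration changes the logarithm of the moment generating function of
    g(S), around its mean, by at most h^2 e^{|h| t} E|v_j|^2
    ([mgf_bounded_around]).  This gives the Bennett-type bound
    [nonexpansive_sum_mgf]
        E e^{h g(S)} <= exp (h E g(S) + h^2 e^{|h| t} sum_j E|v_j|^2)
    for every real h.  With Q = c t + sqrt c e^{p/c} |S_2|_2 and h = p/Q or
    h = -p/Q, the quadratic term is at most p ([exponent_le]), whence the
    p-norm of g(S) - E g(S) is O(Q).

    Unbounded part.  Let U be the sum of the norms |r_j|.  Since |r_j|/t is 0 or
    at least 1,
        (1 + U/t)^p <= prod_j (1 + (2|r_j|/t)^p),
    and by independence the expectation of the right-hand side is at most
    exp ((2/t)^p sum_j E|r_j|^p).  Because t is at least twice the p-norm of d^*,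
    with probability at least 1/2 no increment exceeds t, and decomposing along
    the first index that exceeds t gives sum_j E|r_j|^p <= 2 (t/2)^p.  So
    E (1 + U/t)^p <= e^2 ([sum_excess_scaled_moment]): both the p-norm and the
    mean of U are O(t).

    Adding the two parts ([moment_inequality]) bounds the left-hand side by an
    absolute constant times c |d^*|_p + sqrt c e^{p/c} |S_2|_2 for every c >= 1
    ([centered_norm_le]).  The other three inequalities are the choices c = p,
    c = 4 p / ln p and c = 2 alpha ([sqrt_expR_le_div_ln],
    [sqrt_expR_le_expR]). *)

Set Implicit Arguments.
Unset Strict Implicit.
Unset Printing Implicit Defensive.

Import Order.TTheory GRing.Theory Num.Theory.
Import numFieldNormedType.Exports.

Local Open Scope classical_set_scope.
Local Open Scope ring_scope.

(** * Borel measurability in a separable normed space *)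

Section borel_measurability.
Context {R : realType} {X : normedModType R}.

Lemma borel_continuous_measurable (g : X -> R) :
  continuous g -> measurable_fun [set: borel X] (g : borel X -> R).
Proof.
move=> /continuousP cg; apply: (measurability _ (RGenOpens.measurableE R)) => //.
move=> _ [_ [a [b ->] <-]]; rewrite setTI; apply: sub_sigma_algebra.
exact/cg/interval_open.
Qed.

Lemma borel_fun_measurable d (T : measurableType d) (Y : T -> X) :
  (forall U : set X, open U -> measurable (Y @^-1` U)) ->
  measurable_fun [set: T] (Y : T -> borel X).
Proof.
move=> mY; apply: (@measurability _ _ _ (borel X) _ _ (@open X)) => //.
by move=> _ [U oU <-]; rewrite setTI; exact: mY.
Qed.

Lemma borel_open_preimage d (T : measurableType d) (Y : T -> X) (U : set X) :
  measurable_fun [set: T] (Y : T -> borel X) -> open U ->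
  measurable (Y @^-1` U).
Proof.
move=> mY oU; rewrite -[_ @^-1` _]setTI; apply: (mY measurableT).
exact: sub_sigma_algebra.
Qed.

(** Separability enters here: it makes the Borel sets of X * X the product
    sigma-algebra, so that addition, which is continuous, is measurable for it.
    Concretely, the preimage of an open set under addition is a countable union
    of products of balls centred in a countable dense set. *)
Lemma measurable_borelD d (T : measurableType d) (Y Z : T -> X) :
  separable X -> measurable_fun [set: T] (Y : T -> borel X) ->
  measurable_fun [set: T] (Z : T -> borel X) ->
  measurable_fun [set: T] ((fun w => Y w + Z w) : T -> borel X).
Proof.
move=> [D cD dD] mY mZ; apply: borel_fun_measurable => U oU.
pose r (k : nat) : R := k.+1%:R^-1.
have r0 k : 0 < r k by rewrite invr_gt0 ltr0n.
(* The pairs of balls of radius [r k], centred in the dense set, whose sum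
   stays inside [U]. *)
pose F (i : D * D * nat) : set T :=
  [set w | (forall y z, ball (sval i.1.1) (r i.2) y ->
      ball (sval i.1.2) (r i.2) z -> U (y + z))] `&`
  (Y @^-1` ball (sval i.1.1) (r i.2) `&` Z @^-1` ball (sval i.1.2) (r i.2)).
have -> : (fun w => Y w + Z w) @^-1` U = \bigcup_i F i.
  apply/seteqP; split=> [w /= Uw|w [[[a b] k] _ [/= h [/h]]]]; last by apply.
  have [e /= e0 eU] : exists2 e : R, 0 < e & ball (Y w + Z w) e `<=` U.
    by apply/nbhs_ballP; exact: open_nbhs_nbhs.
  have [k rk] : exists k, 4 * r k < e.
    have [k ke] := ltr_add_invr (divr_gt0 e0 (ltr0n R 4)).
    exists k; move: ke; rewrite add0r -/(r k) ltr_pdivlMr//; lra.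
  have near_D (y : X) : exists2 a : D, ball (sval a) (r k) y & `|y - sval a| < r k.
    have [|a [/= ya Da]] := dD (ball y (r k)) _ (ball_open _ _).
      by exists y; exact: ballxx.
    exists (exist _ a (mem_set Da)) => /=; first exact: ball_sym.
    by move: ya; rewrite -ball_normE.
  have [a Ya Ya'] := near_D (Y w); have [b Zb Zb'] := near_D (Z w).
  exists (a, b, k) => //; split=> //= y z; rewrite -!ball_normE /= => ay bz.
  apply: eU; rewrite -ball_normE /=.
  have -> : Y w + Z w - (y + z) = (Y w - sval a) + (sval a - y) +
      ((Z w - sval b) + (sval b - z)).
    by rewrite !subrKA opprD addrACA.
  apply: le_lt_trans (ler_normD _ _) _.
  have := ler_normD (Y w - sval a) (sval a - y).
  have := ler_normD (Z w - sval b) (sval b - z).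
  by move: Ya' Zb' ay bz rk; lra.
apply: countable_bigcupT_measurable.
  have cDT : countable [set: D] by rewrite (eq_countable (card_setT D)).
  by rewrite -!setXTT; do 2?apply: countableX.
move=> [[a b] k]; apply: measurableI; last first.
  by apply: measurableI; apply: borel_open_preimage => //; exact: ball_open.
rewrite /=; have [h|h] := pselect (forall y z, ball (sval a) (r k) y ->
      ball (sval b) (r k) z -> U (y + z)).
  by rewrite (_ : [set _ | _] = setT)//; apply/seteqP; split.
by rewrite (_ : [set _ | _] = set0)//; apply/seteqP; split.
Qed.

Lemma measurable_borelN d (T : measurableType d) (Y : T -> X) :
  measurable_fun [set: T] (Y : T -> borel X) ->
  measurable_fun [set: T] ((fun w => - Y w) : T -> borel X).
Proof.
move=> mY; apply: borel_fun_measurable => U oU.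
rewrite (_ : _ @^-1` U = Y @^-1` (-%R @^-1` U))//.
have /continuousP cN : continuous (-%R : X -> X) by exact: opp_continuous.
by apply: borel_open_preimage => //; exact: cN.
Qed.

Lemma measurable_borel_sum d (T : measurableType d) (Y : nat -> T -> X) (n : nat) :
  separable X -> (forall j, (j < n)%N -> measurable_fun [set: T] (Y j : T -> borel X)) ->
  measurable_fun [set: T] ((fun w => \sum_(j < n) Y j w) : T -> borel X).
Proof.
move=> sX; elim: n => [|n IH] mY.
  rewrite (_ : (fun w => _) = cst 0); first exact: measurable_cst.
  by apply/funext => w; rewrite big_ord0.
rewrite (_ : (fun w => _) = fun w => \sum_(j < n) Y j w + Y n w).
  by apply: measurable_borelD => //; [apply: IH => j jn|]; apply: mY => //; exact: ltnW.
by apply/funext => w; rewrite big_ord_recr.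
Qed.

End borel_measurability.

(** * Independence of the past and the next increment *)

Section independence.
Context {R : realType} d (T : measurableType d) (P : probability T R).
Local Open Scope ereal_scope.

(** Independence says that the joint law of [Y] and [Z] agrees with the product
    of their laws on rectangles, hence everywhere; the rest is Tonelli. *)
Lemma independent_tonelli d1 d2 (T1 : measurableType d1) (T2 : measurableType d2)
    (Y : T -> T1) (Z : T -> T2) (F : T1 * T2 -> \bar R) :
  measurable_fun [set: T] Y -> measurable_fun [set: T] Z ->
  (forall A B, measurable A -> measurable B ->
     P (Y @^-1` A `&` Z @^-1` B) = P (Y @^-1` A) * P (Z @^-1` B)) ->
  measurable_fun setT F -> (forall z, 0 <= F z) ->
  \int[P]_w F (Y w, Z w) = \int[P]_w \int[P]_w' F (Y w, Z w').
Proof.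
move=> mY mZ indep mF F0.
pose Y' : {mfun T >-> T1} := HB.pack Y (isMeasurableFun.Build _ _ _ _ Y mY).
pose Z' : {mfun T >-> T2} := HB.pack Z (isMeasurableFun.Build _ _ _ _ Z mZ).
have mYZ : measurable_fun [set: T] (fun w => (Y w, Z w)).
  exact: measurable_fun_pair.
pose T12 : measurableType _ := (T1 * T2)%type.
pose YZ : {mfun T >-> T12} :=
  HB.pack (fun w => (Y w, Z w)) (isMeasurableFun.Build _ _ _ _ _ mYZ).
have eqm : forall A, measurable A ->
    (distribution P Y' \x distribution P Z') A = distribution P YZ A.
  apply: product_measure_unique => A B mA mB.
  by rewrite /distribution /pushforward -indep.
transitivity (\int[distribution P YZ]_z F z).
  by rewrite ge0_integral_distribution.
transitivity (\int[distribution P Y' \x distribution P Z']_z F z).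
  by apply/esym/eq_measure_integral => A mA _; exact: eqm.
rewrite fubini_tonelli1//.
rewrite ge0_integral_distribution//=; first last.
- by move=> y; apply: integral_ge0.
- exact: measurable_fun_fubini_tonelli_F.
apply: eq_integral => w _ /=; rewrite /fubini_F ge0_integral_distribution//.
exact: measurable_fun_pair2.
Qed.

End independence.

Section past.
Context {R : realType} {X : completeNormedModType R}.
Context d (T : measurableType d) (P : probability T R).
Variable D : nat -> T -> X.
Hypothesis mD : forall j, measurable_fun [set: T] (D j : T -> borel X).
Hypothesis indD : independent_vectors P D.

(** A pi-system generating the sigma-algebra of the first [k] increments; that
    sigma-algebra is carried by the same sample space, as the measurable type
    [past k] below. *)
Definition cylinder (k : nat) : set (set T) :=
  [set A | exists2 B : nat -> set (borel X), (forall j, measurable (B j)) &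
    A = \bigcap_(j in [set j | (j < k)%N]) (D j @^-1` B j)].

Notation past k := (g_sigma_algebraType (cylinder k)).

Lemma cylinder_measurable k : cylinder k `<=` @measurable _ T.
Proof.
move=> _ [B mB ->]; apply: bigcap_measurableType => j _.
by rewrite -[_ @^-1` _]setTI; exact: mD.
Qed.

Lemma past_measurable k : @measurable _ (past k) `<=` @measurable _ T.
Proof.
apply: smallest_sub; first exact: sigma_algebra_measurable.
exact: cylinder_measurable.
Qed.

Lemma measurable_past k d' (T' : measurableType d') (Y : T -> T') :
  measurable_fun [set: past k] (Y : past k -> T') -> measurable_fun [set: T] Y.
Proof.
move=> mY _ B mB; apply: (@past_measurable k); exact: mY.
Qed.

Lemma measurable_past_coord k j : (j < k)%N ->
  measurable_fun [set: past k] (D j : past k -> borel X).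
Proof.
move=> jk _ B mB; rewrite setTI; apply: sub_sigma_algebra.
exists (fun i => if i == j then B else setT).
  by move=> i; case: ifP => // _; exact: measurableT.
apply/seteqP; split=> [w /= Bw i /= ik|w /(_ j jk)] /=; last by rewrite eqxx.
by case: eqP => // ->.
Qed.

(** For a cylinder, the product rule over the index set [0..k] is used twice,
    with an arbitrary set and with the full set in position [k], and the common
    product over the indices below [k] is cancelled.  Both sides are finite
    measures in [A], so the identity extends from the pi-system of cylinders to
    the sigma-algebra it generates. *)
Lemma independent_past k (A : set (past k)) (B : set (borel X)) :
  measurable A -> measurable B ->
  P (A `&` D k @^-1` B) = (P A * P (D k @^-1` B))%E.
Proof.
move=> mA mB.
have mDB (C : set (borel X)) : measurable C -> measurable (D k @^-1` C).
  by move=> mC; rewrite -[_ @^-1` _]setTI; exact: mD.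
have indep_cylinder E (C : set (borel X)) : cylinder k E -> measurable C ->
    P (E `&` D k @^-1` C) = (P E * P (D k @^-1` C))%E.
  move=> [B' mB' ->] mC.
  pose J : {fset nat} := seq_fset tt (iota 0 k.+1).
  have memJ j : (j \in J) = (j <= k)%N by rewrite seq_fsetE mem_iota add0n ltnS.
  have kJ : k \in J by rewrite memJ.
  pose Bk (C : set (borel X)) j := if j == k then C else B' j.
  have mBk (C0 : set (borel X)) : measurable C0 -> forall j, measurable (Bk C0 j).
    by move=> mC0 j; rewrite /Bk; case: ifP.
  have capE (C0 : set (borel X)) : \bigcap_(j in [set j | (j < k)%N]) (D j @^-1` B' j) `&`
      D k @^-1` C0 = \bigcap_(j in [set` J]) (D j @^-1` Bk C0 j).
    apply/seteqP; split=> [w [h Ck] j|w h].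
      rewrite /= memJ /Bk leq_eqVlt.
      by case: eqP => [->//|_ /= jk]; exact: h.
    split=> [j jk|].
      have /= := h j; rewrite memJ ltnW// => /(_ isT).
      by rewrite /Bk ltn_eqF.
    by have := h k kJ; rewrite /Bk eqxx.
  have prodE (C0 : set (borel X)) : measurable C0 ->
      P (\bigcap_(j in [set j | (j < k)%N]) (D j @^-1` B' j) `&` D k @^-1` C0) =
      (P (D k @^-1` C0) * \prod_(j <- (J `\ k)%fset) P (D j @^-1` B' j))%E.
    move=> mC0; rewrite capE indD; last exact: mBk.
    rewrite (big_fsetD1 k)//= /Bk eqxx; congr (_ * _)%E.
    apply: eq_big_seq => j; rewrite !inE => /andP[/negbTE jk _].
    by rewrite jk.
  rewrite prodE// muleC; congr (_ * _)%E.
  have := prodE setT measurableT.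
  by rewrite preimage_setT setIT probability_setT mul1e => ->.
pose r : {nonneg R} := NngNum (fine_ge0 (measure_ge0 P (D k @^-1` B))).
have rE : r%:num%:E = P (D k @^-1` B) by rewrite /= fineK// fin_num_measure//; exact: mDB.
have := @g_sigma_algebra_measure_unique _ R T (cylinder k) (@cylinder_measurable k)
  (fun=> setT) _ _ (mrestr P (mDB _ mB)) (mscale r P) _ _ _ A mA.
rewrite /= /mrestr /mscale rE muleC; apply.
- move=> _; exists (fun=> setT); first by move=> j; exact: measurableT.
  by rewrite bigcapT.
- by apply: bigcup_const; exists 0%N.
- move=> _ _ [B1 mB1 ->] [B2 mB2 ->].
  exists (fun j => B1 j `&` B2 j); first by move=> j; exact: measurableI.
  by rewrite -bigcapI.
- by move=> E cE; rewrite indep_cylinder// muleC.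
- by move=> _; rewrite setTI (le_lt_trans (probability_le1 _ _)) ?ltry//; exact: mDB.
Qed.

(** The form in which independence is used throughout: the next increment may be
    integrated on its own, the past being frozen. *)
Lemma past_tonelli k (F : past k * borel X -> \bar R) :
  measurable_fun setT F -> (forall z, 0 <= F z)%E ->
  (\int[P]_w F (w, D k w) = \int[P]_w \int[P]_w' F (w, D k w'))%E.
Proof.
move=> mF F0.
have mid : measurable_fun [set: T] (id : T -> past k).
  by move=> _ B mB; rewrite setTI; exact: (@past_measurable k).
have ind := @independent_past k.
exact: (@independent_tonelli _ _ T P _ _ (past k) (borel X) id (D k) F mid (mD k) ind).
Qed.

End past.

(** * Moment generating function of one bounded variable *)

Lemma expR_le_quadratic {R : realType} (y : R) :
  expR y <= 1 + y + y ^+ 2 * expR `|y|.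
Proof.
have [y0|y0] := leP 0 y.
  rewrite ger0_norm//.
  have /(ler_wpM2r (expR_ge0 y)) := expR_ge1Dx (- y).
  rewrite -expRD addNr expR0 => h1.
  have h2 : y * expR y - y <= y * (y * expR y).
    by rewrite -[X in _ - X]mulr1 -mulrBr ler_wpM2l//; lra.
  rewrite expr2 -mulrA; lra.
rewrite ltr0_norm//; set z := - y.
have z0 : 0 < z by rewrite /z oppr_gt0.
have h1 : expR y * (1 + z) <= 1.
  have := ler_wpM2l (expR_ge0 y) (expR_ge1Dx z).
  by rewrite -expRD /z addrN expR0.
have h2 : expR y <= 1 - z + z ^+ 2.
  rewrite -(ler_pM2r (_ : 0 < 1 + z)); last by rewrite addr_gt0.
  rewrite (le_trans h1)//.
  by have := exprn_gt0 3 z0; nra.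
have h3 : z ^+ 2 <= z ^+ 2 * expR z.
  by rewrite ler_peMr ?sqr_ge0//; have := expR_ge1Dx z; lra.
by rewrite /z in h2 h3 *; rewrite sqrrN in h2 h3; lra.
Qed.

Section integral_facts.
Context {R : realType} d (T : measurableType d).

(** The integral of a nonnegative function is the supremum of the integrals of
    the simple functions below it, so monotonicity holds for arbitrary functions;
    this dispenses with measurability arguments for majorants such as powers of
    d^*. *)
Lemma le_integral_ge0 (mu : {measure set T -> \bar R}) (f g : T -> \bar R) :
  (forall w, 0 <= f w)%E -> (forall w, f w <= g w)%E ->
  (\int[mu]_w f w <= \int[mu]_w g w)%E.
Proof.
move=> f0 fg.
have g0 w : (0 <= g w)%E by exact: le_trans (fg w).
rewrite !ge0_integralTE//; apply: le_ereal_sup => _ [h hf <-].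
by exists h => // w; exact: le_trans (fg w).
Qed.

Context (P : probability T R).

Lemma bounded_integrable (f : T -> R) (M : R) :
  measurable_fun [set: T] f -> (forall w, `|f w| <= M) ->
  P.-integrable [set: T] (EFin \o f).
Proof.
move=> mf fM; apply: measurable_bounded_integrable => //.
  by rewrite (le_lt_trans (probability_le1 P measurableT))// ltry.
exists M; split; first exact: num_real.
by move=> y My w _ /=; rewrite (le_trans (fM w))// ltW.
Qed.

Lemma EFin_Rintegral (f : T -> R) : P.-integrable [set: T] (EFin \o f) ->
  (\int[P]_w f w)%:E = (\int[P]_w (f w)%:E)%E.
Proof. by move=> fi; rewrite /Rintegral fineK//; exact: integrable_fin_num fi. Qed.

Lemma Rintegral_cst_probability (r : R) : \int[P]_w r = r.
Proof.
by rewrite Rintegral_cst// [X in fine X](@probability_setT _ _ _ P) mulr1.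
Qed.

Lemma integrable_scale (k : R) (f : T -> R) :
  P.-integrable [set: T] (EFin \o f) ->
  P.-integrable [set: T] (EFin \o (fun w => k * f w)).
Proof. by move=> fi; exact: (integrableZl measurableT k fi). Qed.

Lemma integrable_add (f g : T -> R) :
  P.-integrable [set: T] (EFin \o f) -> P.-integrable [set: T] (EFin \o g) ->
  P.-integrable [set: T] (EFin \o (fun w => f w + g w)).
Proof. by move=> fi gi; exact: (integrableD measurableT fi gi). Qed.

(** Integrate the inequality e^y <= 1 + y + y^2 e^{|y|} at y = h W and use
    1 + u <= e^u. *)
Lemma mgf_bounded (W V : T -> R) (h t : R) :
  measurable_fun [set: T] W -> measurable_fun [set: T] V ->
  (forall w, `|W w| <= V w) -> (forall w, V w <= t) ->
  (\int[P]_w (expR (h * W w))%:E <=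
   (expR (h * \int[P]_w W w +
          h ^+ 2 * expR (`|h| * t) * \int[P]_w (V w ^+ 2)))%:E)%E.
Proof.
move=> mW mV WV Vt; set K := h ^+ 2 * expR (`|h| * t).
have V0 w : 0 <= V w by exact: le_trans (WV w).
have K0 : 0 <= K by rewrite mulr_ge0 ?sqr_ge0 ?expR_ge0.
have mV2 : measurable_fun [set: T] (fun w => V w ^+ 2) by exact: measurable_funX.
have iW : P.-integrable [set: T] (EFin \o W).
  by apply: (@bounded_integrable _ t) => // w; exact: le_trans (WV w) (Vt w).
have iV : P.-integrable [set: T] (EFin \o (fun w => V w ^+ 2)).
  apply: (@bounded_integrable _ (t ^+ 2)) => // w.
  by rewrite ger0_norm ?sqr_ge0// ler_sqr ?nnegrE// (le_trans (V0 w)).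
have ih : P.-integrable [set: T] (EFin \o (fun w => h * W w)) by exact: integrable_scale.
have iK : P.-integrable [set: T] (EFin \o (fun w => K * V w ^+ 2)).
  exact: integrable_scale.
have ihK : P.-integrable [set: T] (EFin \o (fun w => h * W w + K * V w ^+ 2)).
  exact: integrable_add.
have i1 : P.-integrable [set: T] (EFin \o (fun=> 1 : R)).
  by apply: (@bounded_integrable _ 1) => // w; rewrite normr1.
apply: (@le_trans _ _ (\int[P]_w (1 + (h * W w + K * V w ^+ 2))%:E)%E).
  apply: le_integral_ge0 => w; first by rewrite lee_fin expR_ge0.
  rewrite lee_fin addrA; apply: le_trans (expR_le_quadratic _) _.
  rewrite lerD2l exprMn mulrAC /K -[leLHS]mulrA -[leRHS]mulrA ler_wpM2l ?sqr_ge0//.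
  apply: ler_pM; rewrite ?expR_ge0 ?sqr_ge0//.
    by rewrite ler_expR normrM ler_wpM2l// (le_trans (WV w)).
  by rewrite -real_normK ?num_real// ler_sqr ?nnegrE.
rewrite -EFin_Rintegral; last exact: integrable_add.
rewrite lee_fin RintegralD// Rintegral_cst_probability RintegralD//.
by rewrite !RintegralZl//; exact: expR_ge1Dx.
Qed.

(** In the application [a] is the value of a 1-Lipschitz function before an
    increment of norm [V] is added, and [W] its value after; centring at [a]
    rather than at the mean of [W] keeps the deviation below [V]. *)
Lemma mgf_bounded_around (W V : T -> R) (a h t : R) :
  measurable_fun [set: T] W -> measurable_fun [set: T] V ->
  (forall w, `|W w - a| <= V w) -> (forall w, V w <= t) ->
  (\int[P]_w (expR (h * W w))%:E <=
   (expR (h * \int[P]_w W w +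
          h ^+ 2 * expR (`|h| * t) * \int[P]_w (V w ^+ 2)))%:E)%E.
Proof.
move=> mW mV WV Vt.
have mWa : measurable_fun [set: T] (fun w => W w - a) by exact: measurable_funB.
have iWa : P.-integrable [set: T] (EFin \o (fun w => W w - a)).
  by apply: (@bounded_integrable _ t) => // w; exact: le_trans (WV w) (Vt w).
have ia : P.-integrable [set: T] (EFin \o (fun=> a)).
  exact: (@bounded_integrable _ `|a|).
have -> : \int[P]_w W w = \int[P]_w (W w - a) + a.
  rewrite -[X in _ + X]Rintegral_cst_probability -RintegralD//.
  by congr fine; apply: eq_integral => w _; rewrite subrK.
have -> : (\int[P]_w (expR (h * W w))%:E =
    (expR (h * a))%:E * \int[P]_w (expR (h * (W w - a)))%:E)%E.
  rewrite -ge0_integralZl_EFin ?expR_ge0//.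
  - by apply: eq_integral => w _; rewrite -EFinM -expRD -mulrDr addrC subrK.
  - apply/measurable_EFinP; apply: (measurableT_comp (@measurable_expR R)).
    by apply: measurable_funM => //; exact: measurable_cst.
apply: (@le_trans _ _ ((expR (h * a))%:E * (expR (h * \int[P]_w (W w - a) +
          h ^+ 2 * expR (`|h| * t) * \int[P]_w (V w ^+ 2)))%:E)%E).
  by apply: lee_wpmul2l; [rewrite lee_fin expR_ge0|exact: mgf_bounded].
by rewrite -EFinM -expRD lee_fin ler_expR mulrDr [X in _ <= X + _]addrC addrA.
Qed.

End integral_facts.

(** * Exponential bound for 1-Lipschitz functions of truncated sums *)

Notation nonexpansive g := (forall y z, `|g y - g z| <= `|y - z|).

Lemma nonexpansive_continuous {R : realType} {X : normedModType R} (g : X -> R) :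
  nonexpansive g -> continuous g.
Proof.
move=> g1 y; apply/cvgrPdist_lt => e e0.
near=> z; apply: le_lt_trans (g1 _ _) _.
near: z; exact: cvgr_dist_lt.
Unshelve. all: by end_near. Qed.

Section concentration.
Context {R : realType} {X : completeNormedModType R}.
Hypothesis sepX : separable X.
Context d (T : measurableType d) (P : probability T R).
Variable D : nat -> T -> X.
Hypothesis mD : forall j, measurable_fun [set: T] (D j : T -> borel X).
Hypothesis indD : independent_vectors P D.

Notation past k := (g_sigma_algebraType (cylinder D k)).

(** Tonelli for bounded real functions, obtained by applying [past_tonelli] to
    the nonnegative function [M + F]. *)
Lemma past_Rintegral k (F : past k * borel X -> R) (M : R) :
  measurable_fun setT F -> (forall z, `|F z| <= M) ->
  \int[P]_w F (w, D k w) = \int[P]_w \int[P]_w' F (w, D k w').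
Proof.
move=> mF FM.
have mid : measurable_fun [set: T] (id : T -> past k).
  by move=> _ B mB; rewrite setTI; exact: (@past_measurable _ _ _ _ D mD k).
have mFD w : measurable_fun [set: T] (fun w' => F (w, D k w')).
  apply: (measurableT_comp mF).
  by apply: measurable_fun_pair; [exact: measurable_cst|exact: mD].
have mFD2 : measurable_fun [set: T] (fun w => F (w, D k w)).
  by apply: (measurableT_comp mF); apply: measurable_fun_pair; [exact: mid|exact: mD].
have iFD w : P.-integrable [set: T] (EFin \o (fun w' => F (w, D k w'))).
  by apply: (@bounded_integrable _ _ _ _ _ M).
have iM : P.-integrable [set: T] (EFin \o (fun _ : T => M)).
  apply: (@bounded_integrable _ _ _ _ _ M) => // w.
  by rewrite ger0_norm// (le_trans (normr_ge0 _) (FM (w, D k w))).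
have bI w : `|\int[P]_w' F (w, D k w')| <= M.
  apply: le_trans (le_normr_Rintegral _ _) _ => //.
  rewrite -[leRHS](@Rintegral_cst_probability _ _ _ P).
  apply: le_Rintegral => //; apply: (@bounded_integrable _ _ _ _ _ M) => //.
    exact: measurableT_comp.
  by move=> w'; rewrite normr_id.
have mI : measurable_fun [set: T] (fun w => \int[P]_w' F (w, D k w')).
  pose f (z : T * T) : \bar R := (M + F (z.1, D k z.2))%:E.
  have mf : measurable_fun setT f.
    apply/measurable_EFinP; apply: measurable_funD; first exact: measurable_cst.
    apply: (measurableT_comp mF); apply: measurable_fun_pair.
      exact: (measurableT_comp mid measurable_fst).
    exact: (measurableT_comp (mD k) measurable_snd).
  have f0 z : (0 <= f z)%E by have := FM (z.1, D k z.2); rewrite lee_fin ler_norml; lra.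
  have := measurable_fun_fubini_tonelli_F (m2 := P) f mf f0; rewrite /fubini_F => mIf.
  rewrite (_ : (fun w => _) = fun w => fine (\int[P]_w' f (w, w'))%E - M).
    apply: measurable_funB; last exact: measurable_cst.
    exact: (measurableT_comp (fine_measurable measurableT)).
  apply/funext => w; rewrite /f /= -[X in _ = X - _]/(\int[P]_w' (M + F (w, D k w'))).
  by rewrite RintegralD// Rintegral_cst_probability addrAC subrr add0r.
have iI : P.-integrable [set: T] (EFin \o (fun w => \int[P]_w' F (w, D k w'))).
  exact: (@bounded_integrable _ _ _ _ _ M).
have iFD2 : P.-integrable [set: T] (EFin \o (fun w => F (w, D k w))).
  by apply: (@bounded_integrable _ _ _ _ _ M).
apply: (@addrI _ M); rewrite -[in LHS](@Rintegral_cst_probability _ _ _ P M).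
rewrite -[in RHS](@Rintegral_cst_probability _ _ _ P M) -!RintegralD//.
congr fine.
have := @past_tonelli _ _ _ _ P D mD indD k (fun z => (M + F z)%:E).
move=> ->.
- apply: eq_integral => w _; rewrite -EFin_Rintegral; last exact: integrable_add.
  by rewrite RintegralD// Rintegral_cst_probability.
- by apply/measurable_EFinP; apply: measurable_funD => //; exact: measurable_cst.
- by move=> z; have := FM z; rewrite lee_fin ler_norml; lra.
Qed.

Section truncated.
Variables (phi : X -> X) (t : R).
Hypothesis mphi : measurable_fun [set: borel X] (phi : borel X -> borel X).
Hypothesis phit : forall y, `|phi y| <= t.

Let S k w : X := \sum_(j < k) phi (D j w).

Lemma truncated_sum_past k :
  measurable_fun [set: past k] (S k : past k -> borel X).
Proof.
apply: (@measurable_borel_sum _ _ _ (past k) (fun j w => phi (D j w)) k sepX) => j jk.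
exact: (measurableT_comp mphi (@measurable_past_coord _ _ _ _ D _ _ jk)).
Qed.

Lemma truncated_sum_le k w : `|S k w| <= k%:R * t.
Proof.
apply: le_trans (ler_norm_sum _ _ _) _.
apply: le_trans (ler_sum _ (fun (i : 'I_k) _ => phit (D i w))) _.
by rewrite sumr_const card_ord mulr_natl.
Qed.

(** Induction on the number of terms, for all 1-Lipschitz functions at once.
    Averaging g (y + phi (D k)) over the last increment defines a function G of y
    that is again 1-Lipschitz, has the same mean along the shorter sum, and, by
    [mgf_bounded_around] applied for each fixed past, controls the exponential
    moment of g along the longer one. *)
Lemma nonexpansive_sum_mgf (k : nat) (g : X -> R) (h : R) : nonexpansive g ->
  (\int[P]_w (expR (h * g (S k w)))%:E <=
   (expR (h * \int[P]_w g (S k w) + h ^+ 2 * expR (`|h| * t) *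
      \sum_(j < k) \int[P]_w (`|phi (D j w)| ^+ 2)))%:E)%E.
Proof.
have t0 : 0 <= t by exact: le_trans (phit 0).
elim: k g => [|k IH] g g1.
  have -> : S 0 = fun=> 0 by apply/funext => w; rewrite /S big_ord0.
  rewrite big_ord0 mulr0 addr0 Rintegral_cst_probability integral_cst//.
  by rewrite [X in (_ * X)%E](@probability_setT _ _ _ P) mule1.
have cg := nonexpansive_continuous g1.
have mg := borel_continuous_measurable cg.
have mpD : measurable_fun [set: T] (fun w => `|phi (D k w)|).
  apply: (measurableT_comp (borel_continuous_measurable (@norm_continuous _ X))).
  exact: (measurableT_comp mphi (mD k)).
pose G y := \int[P]_w g (y + phi (D k w)).
have mgy y : measurable_fun [set: T] (fun w => g (y + phi (D k w))).
  apply: (measurableT_comp mg); apply: measurable_borelD => //.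
  exact: (measurableT_comp mphi (mD k)).
have gy y w : `|g (y + phi (D k w)) - g y| <= `|phi (D k w)|.
  by apply: le_trans (g1 _ _) _; rewrite addrAC subrr add0r.
have igy y : P.-integrable [set: T] (EFin \o (fun w => g (y + phi (D k w)))).
  apply: (@bounded_integrable _ _ _ _ _ (`|g y| + t)) => // w.
  have := gy y w; have := phit (D k w).
  have := ler_normD (g (y + phi (D k w)) - g y) (g y); rewrite subrK; lra.
have G1 : nonexpansive G.
  move=> y z; rewrite /G -RintegralB//.
  have mB : measurable_fun [set: T]
      (fun w => g (y + phi (D k w)) - g (z + phi (D k w))) by exact: measurable_funB.
  have gB w : `|g (y + phi (D k w)) - g (z + phi (D k w))| <= `|y - z|.
    by apply: le_trans (g1 _ _) _; rewrite opprD addrACA subrr addr0.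
  apply: le_trans (le_normr_Rintegral _ _) _ => //.
    exact: (@bounded_integrable _ _ _ _ _ `|y - z|).
  rewrite -[leRHS](@Rintegral_cst_probability _ _ _ P).
  apply: le_Rintegral => //; apply: (@bounded_integrable _ _ _ _ _ `|y - z|) => //.
  - exact: measurableT_comp.
  - by move=> w; rewrite normr_id.
  - by move=> w; rewrite normr_id.
pose F (z : past k * borel X) : R := g (S k z.1 + phi z.2).
have mF : measurable_fun setT F.
  apply: (measurableT_comp mg); apply: measurable_borelD => //.
    exact: (measurableT_comp (@truncated_sum_past k) measurable_fst).
  exact: (measurableT_comp mphi measurable_snd).
have FM z : `|F z| <= `|g 0| + (k%:R * t + t).
  have := g1 (S k z.1 + phi z.2) 0; rewrite subr0 => g10.
  have := ler_normD (S k z.1) (phi z.2); have := phit z.2.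
  have := truncated_sum_le k z.1.
  by have := ler_normD (F z - g 0) (g 0); rewrite subrK; move: g10; rewrite /F; lra.
have SE w : S k.+1 w = S k w + phi (D k w) by rewrite /S big_ord_recr.
have EG : \int[P]_w g (S k.+1 w) = \int[P]_w G (S k w).
  rewrite -(past_Rintegral mF FM); apply: eq_Rintegral => w _.
  by rewrite SE.
set b := \int[P]_w (`|phi (D k w)| ^+ 2); set K := h ^+ 2 * expR (`|h| * t).
have mSk : measurable_fun [set: T] (S k : T -> borel X).
  exact: (measurable_past mD (@truncated_sum_past k)).
apply: (@le_trans _ _ (\int[P]_w ((expR (K * b))%:E * (expR (h * G (S k w)))%:E))%E).
  under eq_integral do rewrite SE.
  rewrite (@past_tonelli _ _ _ _ P D mD indD k (fun z => (expR (h * F z))%:E)).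
  - apply: le_integral_ge0 => w.
      by apply: integral_ge0 => w' _; rewrite lee_fin expR_ge0.
    rewrite -EFinM -expRD [in leRHS]addrC.
    exact: (mgf_bounded_around P h (mgy (S k w)) mpD (gy (S k w)) (fun w' => phit (D k w'))).
  - apply/measurable_EFinP; apply: (measurableT_comp (@measurable_expR R)).
    by apply: measurable_funM => //; exact: measurable_cst.
  - by move=> z; rewrite lee_fin expR_ge0.
rewrite ge0_integralZl_EFin ?expR_ge0//; last first.
  apply/measurable_EFinP; apply: (measurableT_comp (@measurable_expR R)).
  apply: measurable_funM; first exact: measurable_cst.
  apply: (measurableT_comp (borel_continuous_measurable (nonexpansive_continuous G1))).
  exact: mSk.
apply: le_trans (lee_wpmul2l _ (IH _ G1)) _; first by rewrite lee_fin expR_ge0.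
rewrite -EFinM -expRD lee_fin ler_expR EG big_ord_recr/= mulrDr -/b -/K.
by rewrite addrCA [X in _ <= _ + X]addrC.
Qed.

End truncated.
End concentration.

(** * Real inequalities *)

Section real_inequalities.
Context {R : realType}.

(** This is u <= e^u at u = h|y|/p, raised to the power p. *)
Lemma powR_le_expR (y h p : R) : 0 < h -> 0 < p ->
  `|y| `^ p <= (p / h) `^ p * (expR (h * y) + expR (- h * y)).
Proof.
move=> h0 p0.
have yE : `|y| <= (p / h) * expR (h * `|y| / p).
  have -> : `|y| = (p / h) * (h * `|y| / p) by field; rewrite !gt_eqF.
  rewrite [in leRHS](_ : h * (p / h * (h * `|y| / p)) / p = h * `|y| / p); last first.
    by field; rewrite !gt_eqF.
  rewrite ler_wpM2l ?divr_ge0 ?ltW//.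
  by have := expR_ge1Dx (h * `|y| / p); lra.
have pos : 0 <= p / h * expR (h * `|y| / p).
  by rewrite mulr_ge0 ?expR_ge0 ?divr_ge0 ?ltW.
apply: (@le_trans _ _ ((p / h * expR (h * `|y| / p)) `^ p)).
  by apply: ge0_ler_powR => //; rewrite ?nnegrE// ltW.
rewrite powRM ?expR_ge0 ?divr_ge0 ?(ltW p0) ?(ltW h0)//.
rewrite ler_wpM2l ?powR_ge0// -expRM divfK ?gt_eqF//.
have [y0|y0] := leP 0 y; first by rewrite ger0_norm// lerDl expR_ge0.
by rewrite ltr0_norm// mulrN mulNr lerDr expR_ge0.
Qed.

Lemma powR_add3_le (a b c p : R) : 0 <= a -> 0 <= b -> 0 <= c -> 0 <= p ->
  (a + b + c) `^ p <= 3 `^ p * (a `^ p + b `^ p + c `^ p).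
Proof.
move=> a0 b0 c0 p0; pose m := Num.max a (Num.max b c).
have am : a <= m by rewrite le_max lexx.
have bm : b <= m by rewrite !le_max lexx orbT.
have cm : c <= m by rewrite !le_max lexx !orbT.
have m0 : 0 <= m by exact: le_trans am.
apply: (@le_trans _ _ ((3 * m) `^ p)).
  by apply: ge0_ler_powR => //; rewrite ?nnegrE; lra.
rewrite powRM//; apply: ler_wpM2l; first exact: powR_ge0.
have := powR_ge0 a p; have := powR_ge0 b p; have := powR_ge0 c p.
rewrite /m !maxEle; case: (b <= c); case: (a <= _); move=> *; lra.
Qed.

(** The sum 1 + sum x_j is at most the product of the 1 + x_j, and
    (1 + x)^p <= 1 + (2x)^p whenever x = 0 or x >= 1. *)
Lemma powR_add1_sum_le (x : nat -> R) (p : R) (n : nat) :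
  0 <= p -> (forall j, x j = 0 \/ 1 <= x j) ->
  (1 + \sum_(j < n) x j) `^ p <= \prod_(j < n) (1 + (2 * x j) `^ p).
Proof.
move=> p0 x01.
have x0 j : 0 <= x j by case: (x01 j); lra.
have xj j : (1 + x j) `^ p <= 1 + (2 * x j) `^ p.
  case: (x01 j) => [->|x1]; first by rewrite addr0 powR1 lerDl powR_ge0.
  apply: (@le_trans _ _ ((2 * x j) `^ p)); last by rewrite lerDr.
  by apply: ge0_ler_powR => //; rewrite ?nnegrE; lra.
elim: n => [|n IH]; first by rewrite !big_ord0 addr0 powR1.
have s0 : 0 <= \sum_(j < n) x j by exact: sumr_ge0.
rewrite !big_ord_recr /=.
apply: (@le_trans _ _ ((1 + \sum_(j < n) x j) `^ p * (1 + x n) `^ p)).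
  rewrite -powRM ?addr_ge0//; apply: ge0_ler_powR => //.
  - by rewrite nnegrE !addr_ge0.
  - by rewrite nnegrE mulr_ge0// addr_ge0.
  - have := mulr_ge0 s0 (x0 n); lra.
by apply: ler_pM => //; exact: powR_ge0.
Qed.

(** When the [b j] are 0 or 1, at most one term of the sum is nonzero: the one at
    the first index with [b j = 0].  The sharper right-hand side is what the
    induction needs. *)
Lemma first_exceedance_le (a b : nat -> R) (c : R) (n : nat) :
  (forall j, 0 <= b j) -> (forall j, (j < n)%N -> a j <= c * (1 - b j)) ->
  \sum_(j < n) (\prod_(i < j) b i) * a j <= c * (1 - \prod_(i < n) b i).
Proof.
move=> b0; elim: n => [|n IH] ab; first by rewrite !big_ord0 subrr mulr0.
rewrite !big_ord_recr /=.
have q0 : 0 <= \prod_(i < n) b i by apply: prodr_ge0 => i _; exact: b0.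
have := ler_wpM2l q0 (ab n (ltnSn n)).
have := IH (fun j jn => ab j (ltnW jn)).
set s := \sum_(i < n) _; set q := \prod_(i < n) _; lra.
Qed.

End real_inequalities.

(** * From exponential to power moments *)

Section moments.
Context {R : realType} d (T : measurableType d) (P : probability T R).

Lemma moment_le_mgf (Y : T -> R) (m h p b : R) :
  measurable_fun [set: T] Y -> 0 < h -> 0 < p ->
  (\int[P]_w (expR (h * Y w))%:E <= (expR (h * m + b))%:E)%E ->
  (\int[P]_w (expR (- h * Y w))%:E <= (expR (- h * m + b))%:E)%E ->
  (\int[P]_w (`|Y w - m| `^ p)%:E <= ((p / h) `^ p * (2 * expR b))%:E)%E.
Proof.
move=> mY h0 p0 Yp Yn; set K := (p / h) `^ p.
have K0 : 0 <= K by exact: powR_ge0.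
have mE a : measurable_fun [set: T] (fun w => expR (a * Y w)).
  apply: (measurableT_comp (@measurable_expR R)).
  by apply: measurable_funM => //; exact: measurable_cst.
have mZ a b0 : measurable_fun [set: T] (fun w => (b0%:E * (expR (a * Y w))%:E)%E).
  under eq_fun do rewrite -EFinM.
  by apply/measurable_EFinP; apply: measurable_funM => //; exact: measurable_cst.
apply: (@le_trans _ _ (\int[P]_w ((K * expR (- (h * m)))%:E * (expR (h * Y w))%:E +
    (K * expR (h * m))%:E * (expR (- h * Y w))%:E))%E).
  apply: le_integral_ge0 => w; first by rewrite lee_fin powR_ge0.
  rewrite -!EFinM -EFinD lee_fin -!mulrA -!expRD -mulrDr.
  rewrite (_ : - (h * m) + _ = h * (Y w - m)); last by ring.
  by rewrite (_ : h * m + _ = - h * (Y w - m)); [exact: powR_le_expR|ring].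
rewrite ge0_integralD//; first last.
- by move=> w _; rewrite -EFinM lee_fin !mulr_ge0 ?expR_ge0.
- by move=> w _; rewrite -EFinM lee_fin !mulr_ge0 ?expR_ge0.
rewrite !ge0_integralZl_EFin ?mulr_ge0 ?expR_ge0//; do 2?[exact/measurable_EFinP];
  do 2?[by move=> w _; rewrite lee_fin expR_ge0].
apply: le_trans (leeD (lee_wpmul2l _ Yp) (lee_wpmul2l _ Yn)) _.
- by rewrite lee_fin mulr_ge0// expR_ge0.
- by rewrite lee_fin mulr_ge0// expR_ge0.
rewrite -!EFinM -EFinD lee_fin -!mulrA -!expRD -mulrDr.
by rewrite addrA addNr add0r addrA mulNr addrN add0r ler_wpM2l// mulr2n mulrDl mul1r.
Qed.

End moments.

(** * The part of the increments above the truncation level *)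

Section tails.
Context {R : realType} {X : completeNormedModType R}.
Context d (T : measurableType d) (P : probability T R).
Variable D : nat -> T -> X.
Hypothesis mD : forall j, measurable_fun [set: T] (D j : T -> borel X).
Hypothesis indD : independent_vectors P D.

Notation past k := (g_sigma_algebraType (cylinder D k)).

Lemma expectation_prod (psi : nat -> X -> R) (k : nat) :
  (forall j, measurable_fun [set: borel X] (psi j : borel X -> R)) ->
  (forall j y, 0 <= psi j y) ->
  (\int[P]_w (\prod_(j < k) psi j (D j w))%:E =
   \prod_(j < k) \int[P]_w (psi j (D j w))%:E)%E.
Proof.
move=> mpsi psi0; elim: k => [|k IH].
  rewrite big_ord0; under eq_integral do rewrite big_ord0.
  by rewrite integral_cst// [X in (_ * X)%E](@probability_setT _ _ _ P) mule1.
pose G w := \prod_(j < k) psi j (D j w).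
have G0 w : 0 <= G w by apply: prodr_ge0 => j _.
have mGp : measurable_fun [set: past k] (G : past k -> R).
  apply: measurable_prod => j _.
  exact: (measurableT_comp (mpsi j) (@measurable_past_coord _ _ _ _ D _ _ (ltn_ord j))).
have mG : measurable_fun [set: T] G by exact: (measurable_past mD mGp).
have mpD : measurable_fun [set: T] (fun w => psi k (D k w)).
  exact: (measurableT_comp (mpsi k) (mD k)).
pose F (z : past k * borel X) : \bar R := (G z.1 * psi k z.2)%:E.
transitivity (\int[P]_w F (w, D k w))%E.
  by apply: eq_integral => w _; rewrite big_ord_recr.
rewrite (past_tonelli mD indD).
- rewrite big_ord_recr /= -IH.
  under eq_integral => w _.
    under eq_integral do rewrite /F /= EFinM.
    rewrite ge0_integralZl_EFin//; first last.
    - exact/measurable_EFinP.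
    - by move=> w' _; rewrite lee_fin.
    over.
  rewrite ge0_integralZr//.
  - exact/measurable_EFinP.
  - by move=> w _; rewrite lee_fin.
  - by apply: integral_ge0 => w _; rewrite lee_fin.
- apply/measurable_EFinP; apply: measurable_funM.
    exact: (measurableT_comp mGp measurable_fst).
  exact: (measurableT_comp (mpsi k) measurable_snd).
- by move=> z; rewrite lee_fin mulr_ge0.
Qed.

Variables (t : R) (n : nat).
Hypothesis t0 : 0 < t.
Variable p : R.
Hypothesis p2 : 2 <= p.

(** The norm of the part of [y] removed by truncation at [t]. *)
Definition excess (y : X) : R := if `|y| <= t then 0 else `|y|.

Lemma measurable_norm_borel : measurable_fun [set: borel X] (fun y : borel X => `|y : X|).
Proof. exact: (borel_continuous_measurable (@norm_continuous _ X)). Qed.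

Lemma measurable_norm_le :
  measurable_fun [set: borel X] (fun y : borel X => `|y : X| <= t).
Proof.
by apply: measurable_fun_ler; [exact: measurable_norm_borel|exact: measurable_cst].
Qed.

Lemma measurable_excess : measurable_fun [set: borel X] (excess : borel X -> R).
Proof.
apply: measurable_fun_ifT; first exact: measurable_norm_le.
  exact: measurable_cst.
exact: measurable_norm_borel.
Qed.

Lemma excess_ge0 y : 0 <= excess y.
Proof. by rewrite /excess; case: ifP. Qed.

Lemma excess_dichotomy y : excess y / t = 0 \/ 1 <= excess y / t.
Proof.
rewrite /excess; case: leP => [_|ty]; first by left; rewrite mul0r.
by right; rewrite ler_pdivlMr// mul1r ltW.
Qed.

(* [M] stands for the p-th power of d^*, which may be infinite at some points. *)
Variable M : T -> \bar R.
Hypothesis DM : forall j w, (j < n)%N -> ((`|D j w| `^ p)%:E <= M w)%E.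
Hypothesis M0 : forall w, (0 <= M w)%E.
Hypothesis Mt : (\int[P]_w M w <= ((t / 2) `^ p)%:E)%E.

Let p0 : 0 < p. Proof. exact: lt_le_trans p2. Qed.

Let e j := fine (\int[P]_w (excess (D j w) `^ p)%:E)%E.
Let b (y : X) : R := if `|y| <= t then 1 else 0.
Let q j := fine (\int[P]_w (b (D j w))%:E)%E.

Let mb : measurable_fun [set: borel X] (b : borel X -> R).
Proof.
apply: measurable_fun_ifT; first exact: measurable_norm_le.
  exact: measurable_cst.
exact: measurable_cst.
Qed.

Let mex : measurable_fun [set: borel X] ((fun y => excess y `^ p) : borel X -> R).
Proof. exact: (measurableT_comp (@measurable_powR R p) measurable_excess). Qed.

Let excess_le_M j w : (j < n)%N -> ((excess (D j w) `^ p)%:E <= M w)%E.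
Proof.
move=> jn; apply: le_trans (DM w jn); rewrite lee_fin /excess.
by case: ifP => // _; rewrite powR0 ?powR_ge0// gt_eqF.
Qed.

Let eE j : (j < n)%N -> (\int[P]_w (excess (D j w) `^ p)%:E)%E = (e j)%:E.
Proof.
move=> jn; rewrite /e fineK// ge0_fin_numE; last first.
  by apply: integral_ge0 => w _; rewrite lee_fin powR_ge0.
apply: le_lt_trans (ltry ((t / 2) `^ p)); apply: le_trans Mt.
by apply: le_integral_ge0 => w; [rewrite lee_fin powR_ge0|exact: excess_le_M].
Qed.

Let e0 j : 0 <= e j.
Proof. by apply: fine_ge0; apply: integral_ge0 => w _; rewrite lee_fin powR_ge0. Qed.

Let b01 y : 0 <= b y <= 1.
Proof. by rewrite /b; case: ifP; rewrite lexx ler01. Qed.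

Let qE j : (\int[P]_w (b (D j w))%:E)%E = (q j)%:E.
Proof.
rewrite /q fineK// ge0_fin_numE; last first.
  by apply: integral_ge0 => w _; rewrite lee_fin; case/andP: (b01 (D j w)).
apply: le_lt_trans (ltry 1).
rewrite -[leRHS]mule1 -[X in (_ <= _ * X)%E](@probability_setT _ _ _ P) -integral_cst//.
apply: le_integral_ge0 => w; rewrite lee_fin; by case/andP: (b01 (D j w)).
Qed.

Let q01 j : 0 <= q j <= 1.
Proof.
rewrite -!lee_fin -qE; apply/andP; split.
  by apply: integral_ge0 => w _; rewrite lee_fin; case/andP: (b01 (D j w)).
rewrite -[leRHS]mule1 -[X in (_ <= _ * X)%E](@probability_setT _ _ _ P) -integral_cst//.
apply: le_integral_ge0 => w; rewrite lee_fin; by case/andP: (b01 (D j w)).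
Qed.

Let mbD j : measurable_fun [set: T] (fun w => b (D j w)).
Proof. exact: (measurableT_comp mb (mD j)). Qed.

Let mexD j : measurable_fun [set: T] (fun w => excess (D j w) `^ p).
Proof. exact: (measurableT_comp mex (mD j)). Qed.

Let prod_q k : (\int[P]_w (\prod_(i < k) b (D i w))%:E)%E = (\prod_(i < k) q i)%:E.
Proof.
rewrite (@expectation_prod (fun=> b)) => [||_ y]; last by case/andP: (b01 y).
  by rewrite (big_morph EFin (@EFinM R) (erefl _)); apply: eq_bigr => i _; exact: qE.
by [].
Qed.

(** By independence, the expectation of the p-th power of the [j]-th excess on the
    event that no earlier increment is above [t] factorises. *)
Let first_excess j : (j < n)%N ->
  (\int[P]_w ((\prod_(i < j) b (D i w)) * excess (D j w) `^ p)%:E)%E =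
  ((\prod_(i < j) q i) * e j)%:E.
Proof.
move=> jn.
pose psi i := if i == j then (fun y => excess y `^ p) else b.
have psij : psi j = fun y => excess y `^ p by rewrite /psi eqxx.
have psii (i : 'I_j) : psi i = b by rewrite /psi ltn_eqF.
have := @expectation_prod psi j.+1.
rewrite big_ord_recr /= psij eE// => h.
transitivity (\int[P]_w (\prod_(i < j.+1) psi i (D i w))%:E)%E.
  apply: eq_integral => w _; rewrite big_ord_recr /= psij.
  by congr (_ * _)%:E; apply: eq_bigr => i _; rewrite psii.
rewrite h.
- rewrite EFinM (big_morph EFin (@EFinM R) (erefl _)); congr (_ * _)%E.
  by apply: eq_bigr => i _; rewrite psii; exact: qE.
- by move=> i; rewrite /psi; case: eqP.
- move=> i y; rewrite /psi; case: eqP => _; first exact: powR_ge0.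
  by case/andP: (b01 y).
Qed.

(** At most one index is the first one above [t], and the excess there is at most
    d^*. *)
Let sum_first_excess :
  \sum_(j < n) (\prod_(i < j) q i) * e j <= (t / 2) `^ p.
Proof.
rewrite -lee_fin -sumEFin; apply: le_trans Mt.
rewrite (eq_bigr (fun j : 'I_n => \int[P]_w
    ((\prod_(i < j) b (D i w)) * excess (D j w) `^ p)%:E)%E); last first.
  by move=> j _; rewrite first_excess.
have pb0 k w : 0 <= \prod_(i < k) b (D i w).
  by apply: prodr_ge0 => i _; case/andP: (b01 (D i w)).
rewrite -ge0_integral_sum//; first last.
- by move=> j w _; rewrite lee_fin mulr_ge0// powR_ge0.
- move=> j; apply/measurable_EFinP; apply: measurable_funM => //.
  by apply: measurable_prod => i _; exact: mbD.
apply: le_integral_ge0 => w.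
  by apply: sume_ge0 => j _; rewrite lee_fin mulr_ge0// powR_ge0.
rewrite sumEFin; have := M0 w; case: (M w) (fun j => @excess_le_M j w) => [r| |]//.
  move=> exr r0.
  rewrite lee_fin; apply: le_trans (@first_exceedance_le _
    (fun j => excess (D j w) `^ p) (fun j => b (D j w)) r n _ _) _.
  - by move=> j; case/andP: (b01 (D j w)).
  - move=> j /exr; rewrite lee_fin /b /excess; case: ifP => _; last by rewrite subr0 mulr1.
    by rewrite subrr mulr0 powR0// gt_eqF.
  - by rewrite ler_piMr// lerBlDr lerDl.
by move=> _ _; rewrite leey.
Qed.

(** Markov's inequality for d^* : the probability that some increment is above [t]
    is at most (1/2)^p. *)
Let no_excess : 1 / 2 <= \prod_(i < n) q i.
Proof.
have pb0 w : 0 <= \prod_(i < n) b (D i w).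
  by apply: prodr_ge0 => i _; case/andP: (b01 (D i w)).
have pb1 w : \prod_(i < n) b (D i w) <= 1.
  by apply: prodr_ile1 => i _.
have ipb : P.-integrable [set: T] (EFin \o (fun w => \prod_(i < n) b (D i w))).
  apply: (@bounded_integrable _ _ _ _ _ 1) => [|w]; last by rewrite ger0_norm.
  by apply: measurable_prod => i _; exact: mbD.
have i1 : P.-integrable [set: T] (EFin \o (fun=> 1 : R)).
  by apply: (@bounded_integrable _ _ _ _ _ 1) => // w; rewrite normr1.
have i1pb : P.-integrable [set: T] (EFin \o (fun w => 1 - \prod_(i < n) b (D i w))).
  exact: (integrableB measurableT i1 ipb).
have tp : 0 < t `^ p by exact: powR_gt0.
have h : t `^ p * (1 - \prod_(i < n) q i) <= (t / 2) `^ p.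
  rewrite -lee_fin; apply: le_trans Mt.
  have <- : \int[P]_w (t `^ p * (1 - \prod_(i < n) b (D i w))) =
      t `^ p * (1 - \prod_(i < n) q i).
    rewrite RintegralZl// RintegralB// Rintegral_cst_probability.
    by rewrite /Rintegral prod_q.
  rewrite EFin_Rintegral; last exact: integrable_scale.
  apply: le_integral_ge0 => w; first by rewrite lee_fin mulr_ge0 ?powR_ge0 ?subr_ge0.
  have [/forallP h|/forallPn[j]] := boolP [forall j : 'I_n, `|D j w| <= t].
    rewrite (_ : \prod_(i < n) b (D i w) = 1) ?subrr ?mulr0//.
    by rewrite big1// => i _; rewrite /b h.
  rewrite -ltNge => tD; apply: le_trans (DM w (ltn_ord j)).
  rewrite lee_fin; apply: (@le_trans _ _ (t `^ p)).
    by rewrite ler_piMr ?powR_ge0// lerBlDr lerDl.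
  by apply: ge0_ler_powR; rewrite ?nnegrE// ltW.
have h2 : (t / 2) `^ p <= t `^ p * (1 / 2).
  rewrite (powRM _ (ltW t0))// ler_wpM2l ?powR_ge0//.
  rewrite div1r -[leRHS]powRr1//; apply: ger_powR; first by lra.
  by apply: le_trans p2; lra.
have : t `^ p * (1 - \prod_(i < n) q i) <= t `^ p * (1 / 2) by exact: le_trans h2.
by rewrite ler_pM2l//; lra.
Qed.

(** In the decomposition along the first exceedance each weight is at least the
    probability that nothing exceeds [t], that is at least 1/2. *)
Let sum_e : \sum_(j < n) e j <= 2 * (t / 2) `^ p.
Proof.
rewrite mulrC -ler_pdivrMr//; apply: le_trans sum_first_excess.
rewrite mulr_suml; apply: ler_sum => j _.
rewrite mulrC ler_wpM2r//; apply: le_trans (_ : \prod_(i < n) q i <= _).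
  by have := no_excess; lra.
rewrite -(big_mkord xpredT) -(big_mkord xpredT) (@big_cat_nat _ _ _ j) //=; last exact: ltnW.
rewrite ler_piMr//; first by apply: prodr_ge0 => i _; case/andP: (q01 i).
by apply: prodr_ile1 => i _.
Qed.

Lemma sum_excess_scaled_moment :
  (\int[P]_w ((1 + \sum_(j < n) excess (D j w) / t) `^ p)%:E <= (expR 2)%:E)%E.
Proof.
pose psi (y : X) : R := 1 + (2 / t) `^ p * excess y `^ p.
have tp : 0 <= 2 / t by rewrite divr_ge0// ltW.
apply: (@le_trans _ _ (\int[P]_w (\prod_(j < n) psi (D j w))%:E)%E).
  apply: le_integral_ge0 => w; rewrite lee_fin ?powR_ge0//.
  apply: le_trans (@powR_add1_sum_le _ (fun j => excess (D j w) / t) p n (ltW p0) _) _.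
    by move=> j; exact: excess_dichotomy.
  apply: ler_prod => j _; rewrite addr_ge0 ?powR_ge0//= /psi lerD2l.
  by rewrite mulrA [X in X `^ p]mulrAC powRM ?excess_ge0.
have ipsi (j : 'I_n) : (\int[P]_w (psi (D j w))%:E = (1 + (2 / t) `^ p * e j)%:E)%E.
  under eq_integral do rewrite /psi EFinD EFinM.
  rewrite ge0_integralD//; first last.
  - by apply/measurable_EFinP; apply: measurable_funM => //; exact: measurable_cst.
  - by move=> w _; rewrite -EFinM lee_fin mulr_ge0 ?powR_ge0.
  rewrite integral_cst// [X in (_ * X)%E](@probability_setT _ _ _ P) mule1.
  rewrite ge0_integralZl_EFin ?powR_ge0//; last exact/measurable_EFinP.
    by rewrite eE// EFinD EFinM.
  by move=> w _; rewrite lee_fin powR_ge0.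
have /= prodE := @expectation_prod (fun=> psi) n; rewrite prodE {prodE}.
- rewrite (eq_bigr _ (fun j _ => ipsi j)) -(big_morph EFin (@EFinM R) (erefl _)) lee_fin.
  apply: (@le_trans _ _ (\prod_(j < n) expR ((2 / t) `^ p * e j))).
    by apply: ler_prod => j _; rewrite expR_ge1Dx andbT addr_ge0// mulr_ge0// powR_ge0.
  rewrite -expR_sum ler_expR -mulr_sumr.
  apply: le_trans (ler_wpM2l (powR_ge0 _ _) sum_e) _.
  rewrite mulrCA -powRM ?divr_ge0 ?(ltW t0)//.
  by rewrite (_ : 2 / t * (t / 2) = 1) ?powR1 ?mulr1//; field; rewrite gt_eqF.
- move=> _; apply: measurable_funD; first exact: measurable_cst.
  by apply: measurable_funM => //; exact: measurable_cst.
- by move=> _ y; rewrite addr_ge0// mulr_ge0// powR_ge0.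
Qed.

End tails.

(** * The moment inequality at a fixed truncation level *)

Section optimisation.
Context {R : realType}.

(** Put r = p/c.  The first term of Q gives (p/Q) t <= r and the second gives
    (p s / Q)^2 <= p^2 / (c e^{2r}), so the left-hand side is at most
    p^2 e^{-r} / c = p r e^{-r}, and r <= e^r. *)
Lemma exponent_le (p c t s : R) (Q := c * t + Num.sqrt c * expR (p / c) * s) :
  0 < p -> 1 <= c -> 0 < t -> 0 <= s ->
  (p / Q) ^+ 2 * expR (p / Q * t) * s ^+ 2 <= p.
Proof.
move=> p0 c1 t0 s0; have c0 : 0 < c by exact: lt_le_trans c1.
set r := p / c; have r0 : 0 < r by exact: divr_gt0.
have sc0 : 0 < Num.sqrt c by rewrite sqrtr_gt0.
have v0 : 0 <= Num.sqrt c * expR r * s by rewrite !mulr_ge0 ?expR_ge0 ?sqrtr_ge0.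
have Q0 : 0 < Q by rewrite /Q ltr_pwDl ?mulr_gt0.
have ht : p / Q * t <= r.
  rewrite mulrAC ler_pdivrMr// /r mulrAC ler_pdivlMr// -mulrA ler_wpM2l ?(ltW p0)//.
  by rewrite mulrC /Q lerDl.
have hs : (p / Q) ^+ 2 * s ^+ 2 * (c * expR r ^+ 2) <= p ^+ 2.
  have -> : (p / Q) ^+ 2 * s ^+ 2 * (c * expR r ^+ 2) =
      (p * (Num.sqrt c * expR r * s / Q)) ^+ 2.
    by rewrite -{1}(@sqr_sqrtr _ c) ?(ltW c0)//; field; rewrite gt_eqF.
  have vQ0 : 0 <= Num.sqrt c * expR r * s / Q by rewrite divr_ge0// ltW.
  rewrite ler_sqr ?nnegrE ?(ltW p0) ?(mulr_ge0 (ltW p0) vQ0)//.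
  rewrite ler_piMr ?(ltW p0)// ler_pdivrMr// mul1r /Q lerDr.
  by rewrite mulr_ge0// ltW.
have er : r <= expR r by have := expR_ge1Dx r; lra.
apply: (@le_trans _ _ ((p / Q) ^+ 2 * s ^+ 2 * expR r)).
  rewrite [leLHS]mulrAC; apply: ler_wpM2l; last by rewrite ler_expR.
  by rewrite mulr_ge0 ?sqr_ge0.
rewrite -(ler_pM2r (_ : 0 < c * expR r)); last by rewrite mulr_gt0 ?expR_gt0.
rewrite [leLHS](_ : _ = (p / Q) ^+ 2 * s ^+ 2 * (c * expR r ^+ 2)); last by ring.
apply: le_trans hs _.
rewrite expr2 ler_wpM2l ?(ltW p0)// -[leLHS](divfK (lt0r_neq0 c0)) -/r mulrC.
by rewrite ler_wpM2l// ltW.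
Qed.

End optimisation.

Section moment_inequality.
Context {R : realType} {X : completeNormedModType R}.
Hypothesis sepX : separable X.
Context d (T : measurableType d) (P : probability T R).
Variable D : nat -> T -> X.
Hypothesis mD : forall j, measurable_fun [set: T] (D j : T -> borel X).
Hypothesis indD : independent_vectors P D.

Definition trunc (t : R) (y : X) : X := if `|y| <= t then y else 0.

Lemma measurable_trunc t :
  measurable_fun [set: borel X] (trunc t : borel X -> borel X).
Proof.
apply: measurable_fun_ifT; first exact: measurable_norm_le.
  exact: measurable_id.
exact: measurable_cst.
Qed.

Lemma norm_trunc_le t y : 0 <= t -> `|trunc t y| <= t.
Proof. by move=> t0; rewrite /trunc; case: ifP => //; rewrite normr0. Qed.

Lemma norm_trunc_le_norm t y : `|trunc t y| <= `|y|.
Proof. by rewrite /trunc; case: ifP => //; rewrite normr0. Qed.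

Lemma norm_sub_trunc t y : `|y - trunc t y| = excess t y.
Proof. by rewrite /trunc /excess; case: ifP; rewrite ?subrr ?normr0 ?subr0. Qed.

Lemma measurable_norm_sum (n : nat) (x : X) :
  measurable_fun [set: T] (fun w => `|\sum_(j < n) D j w + x|).
Proof.
apply: (measurableT_comp measurable_norm_borel).
by apply: measurable_borelD => //; apply: measurable_borel_sum.
Qed.

(** The distance of [Z] to its mean is at most |g(S) - E g(S)| + U + E U, where
    g(S) is the norm for the truncated increments and U the sum of the
    excesses: both |Z - g(S)| and |E Z - E g(S)| are controlled by U. *)
Lemma moment_inequality (t p c s : R) (n : nat) (x : X) (M : T -> \bar R)
    (Q := c * t + Num.sqrt c * expR (p / c) * s)
    (Z := fun w => `|\sum_(j < n) D j w + x|) :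
  0 < t -> 2 <= p -> 1 <= c -> 0 <= s ->
  (forall j w, (j < n)%N -> ((`|D j w| `^ p)%:E <= M w)%E) ->
  (forall w, 0 <= M w)%E ->
  (\int[P]_w M w <= ((t / 2) `^ p)%:E)%E ->
  (\sum_(j < n) \int[P]_w (`|D j w| ^+ 2)%:E <= (s ^+ 2)%:E)%E ->
  P.-integrable [set: T] (EFin \o Z) /\
  (\int[P]_w (`|Z w - \int[P]_v Z v| `^ p)%:E <= ((6 * expR 2 * Q) `^ p)%:E)%E.
Proof.
move=> t0 p2 c1 s0 DM M0 Mt Ds.
have p0 : 0 < p by exact: lt_le_trans p2.
have c0 : 0 < c by exact: lt_le_trans c1.
have v0 : 0 <= Num.sqrt c * expR (p / c) * s.
  by rewrite !mulr_ge0 ?expR_ge0 ?sqrtr_ge0.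
have Q0 : 0 < Q by rewrite /Q ltr_pwDl ?mulr_gt0.
have tQ : t <= Q.
  have : t <= c * t by rewrite ler_peMl// ltW.
  by rewrite /Q; lra.
pose phi := trunc t; pose S w := \sum_(j < n) phi (D j w).
pose g (y : X) : R := `|y + x|.
have g1 : nonexpansive g.
  move=> y z; rewrite /g; apply: le_trans (ler_dist_dist _ _) _.
  by rewrite opprD addrACA subrr addr0.
pose U w := \sum_(j < n) excess t (D j w).
have U0 w : 0 <= U w by apply: sumr_ge0 => j _; exact: excess_ge0.
have ZY w : `|Z w - g (S w)| <= U w.
  apply: le_trans (ler_dist_dist _ _) _; rewrite opprD addrACA subrr addr0 -sumrB.
  apply: le_trans (ler_norm_sum _ _ _) _.
  by apply: ler_sum => j _; rewrite norm_sub_trunc.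
have mU : measurable_fun [set: T] U.
  by apply: measurable_sum => j; exact: (measurableT_comp (measurable_excess t) (mD j)).
have mZ : measurable_fun [set: T] Z by exact: measurable_norm_sum.
have mphiD j : measurable_fun [set: T] ((fun w => phi (D j w)) : T -> borel X).
  exact: (measurableT_comp (measurable_trunc t) (mD j)).
have mY : measurable_fun [set: T] (fun w => g (S w)).
  apply: (measurableT_comp (borel_continuous_measurable (nonexpansive_continuous g1))).
  exact: (@measurable_borel_sum _ _ _ _ (fun j w => phi (D j w))).
have phit y : `|phi y| <= t by apply: norm_trunc_le; exact: ltW.
have iY : P.-integrable [set: T] (EFin \o (fun w => g (S w))).
  apply: (@bounded_integrable _ _ _ _ _ (n%:R * t + `|x|)) => // w.
  rewrite ger0_norm ?normr_ge0//; apply: le_trans (ler_normD _ _) _.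
  by rewrite lerD2r; exact: truncated_sum_le.
pose V w := (1 + \sum_(j < n) excess t (D j w) / t) `^ p.
have Vint : (\int[P]_w (V w)%:E <= (expR 2)%:E)%E.
  exact: (@sum_excess_scaled_moment _ _ _ _ _ _ mD indD t n t0 p p2 M DM M0 Mt).
have mV : measurable_fun [set: T] V.
  apply: (measurableT_comp (@measurable_powR R p)).
  apply: measurable_funD; first exact: measurable_cst.
  apply: measurable_sum => j; apply: measurable_funM; last exact: measurable_cst.
  exact: (measurableT_comp (measurable_excess t) (mD j)).
have V0 w : 0 <= V w by exact: powR_ge0.
have UtE w : \sum_(j < n) excess t (D j w) / t = U w / t by rewrite mulr_suml.
have UtV w : U w <= t * V w.
  rewrite /V UtE -ler_pdivrMl// mulrC.
  have u0 : 0 <= U w / t by rewrite divr_ge0// ltW.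
  have : 1 + U w / t <= (1 + U w / t) `^ p by apply: le1r_powR; lra.
  lra.
have UpV w : U w `^ p <= t `^ p * V w.
  rewrite /V UtE -powRM ?(ltW t0) ?addr_ge0 ?divr_ge0 ?(ltW t0)//.
  apply: ge0_ler_powR; rewrite ?nnegrE ?(ltW p0)//.
    by rewrite mulr_ge0 ?addr_ge0 ?divr_ge0 ?(ltW t0).
  by rewrite mulrDr mulr1 mulrCA divff ?gt_eqF// mulr1 lerDr ltW.
have scaleV (k : R) : 0 <= k ->
    (\int[P]_w (k * V w)%:E <= (k * expR 2)%:E)%E.
  move=> k0; under eq_integral do rewrite EFinM.
  rewrite ge0_integralZl_EFin//; first by rewrite EFinM lee_wpmul2l.
  - by move=> w _; rewrite lee_fin.
  - exact/measurable_EFinP.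
have EU : (\int[P]_w (U w)%:E <= (t * expR 2)%:E)%E.
  by apply: le_trans (scaleV t (ltW t0)); apply: le_integral_ge0 => w; rewrite lee_fin.
have iU : P.-integrable [set: T] (EFin \o U).
  apply/integrableP; split; first exact/measurable_EFinP.
  apply: le_lt_trans (ltry (t * expR 2)); apply: le_trans EU.
  by apply: le_integral_ge0 => w //=; rewrite lee_fin ger0_norm.
have iZY : P.-integrable [set: T] (EFin \o (fun w => Z w - g (S w))).
  apply: (le_integrable measurableT) iU; first exact/measurable_EFinP/measurable_funB.
  by move=> w _; rewrite lee_fin (ger0_norm (U0 w)).
have iZ : P.-integrable [set: T] (EFin \o Z).
  have := integrable_add iZY iY; congr (integrable _ _ _).
  by apply/funext => w /=; rewrite subrK.
split=> //.
set m := \int[P]_w g (S w); set a := \int[P]_v Z v.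
have am : `|a - m| <= t * expR 2.
  rewrite /a /m -RintegralB//.
  apply: le_trans (le_normr_Rintegral _ _) _ => //.
  rewrite -lee_fin; apply: le_trans EU.
  rewrite EFin_Rintegral; last first.
    by have := integrable_abse iZY; congr (integrable _ _ _); apply/funext.
  by apply: le_integral_ge0 => w; rewrite lee_fin.
have moment : (\int[P]_w (`|g (S w) - m| `^ p)%:E <= (Q `^ p * (2 * expR p))%:E)%E.
  pose h := p / Q; have h0 : 0 < h by exact: divr_gt0.
  have -> : Q = p / h by rewrite /h; field; rewrite !gt_eqF.
  pose b := \sum_(j < n) \int[P]_w (`|phi (D j w)| ^+ 2).
  have bs : b <= s ^+ 2.
    rewrite -lee_fin; apply: le_trans Ds; rewrite -sumEFin; apply: lee_sum => j _.
    rewrite EFin_Rintegral; last first.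
      apply: (@bounded_integrable _ _ _ _ _ (t ^+ 2)) => [|w].
        apply: measurable_funX; exact: (measurableT_comp measurable_norm_borel (mphiD j)).
      by rewrite ger0_norm ?sqr_ge0// ler_sqr ?nnegrE// ltW.
    apply: le_integral_ge0 => w; rewrite lee_fin ?sqr_ge0//.
    by rewrite ler_sqr ?nnegrE//; exact: norm_trunc_le_norm.
  have bp : h ^+ 2 * expR (h * t) * b <= p.
    apply: le_trans (exponent_le p0 c1 t0 s0); rewrite -/Q -/h.
    by rewrite ler_wpM2l// mulr_ge0 ?sqr_ge0 ?expR_ge0.
  apply: moment_le_mgf => //.
    apply: le_trans (nonexpansive_sum_mgf sepX mD indD (measurable_trunc t) phit n h g1) _.
    by rewrite lee_fin ler_expR lerD2l (gtr0_norm h0).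
  apply: le_trans (nonexpansive_sum_mgf sepX mD indD (measurable_trunc t) phit n (- h) g1) _.
  by rewrite lee_fin ler_expR lerD2l sqrrN normrN (gtr0_norm h0).
(* Of the factor 6 in the bound, 3 comes from splitting into three terms and 2
   from 4 <= 2^p. *)
pose K := 3 `^ p : R.
apply: (@le_trans _ _ (\int[P]_w (K%:E * ((`|g (S w) - m| `^ p)%:E + (t `^ p * V w)%:E +
    ((t * expR 2) `^ p)%:E)))%E).
  apply: le_integral_ge0 => w; first by rewrite lee_fin powR_ge0.
  rewrite -!EFinD -EFinM lee_fin.
  apply: (@le_trans _ _ ((`|g (S w) - m| + U w + t * expR 2) `^ p)).
    apply: ge0_ler_powR; rewrite ?nnegrE ?(ltW p0) ?addr_ge0 ?mulr_ge0 ?expR_ge0 ?(ltW t0)//.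
    have -> : Z w - a = (g (S w) - m) + (Z w - g (S w)) + (m - a) by ring.
    apply: le_trans (ler_normD _ _) _; apply: lerD; last by rewrite distrC.
    by apply: le_trans (ler_normD _ _) _; rewrite lerD2l.
  apply: le_trans (powR_add3_le _ _ _ _) _; rewrite ?mulr_ge0 ?expR_ge0 ?(ltW t0) ?(ltW p0)//.
  by rewrite ler_wpM2l ?powR_ge0// lerD2r lerD2l.
have m1 : measurable_fun [set: T] (fun w => (`|g (S w) - m| `^ p)%:E).
  apply/measurable_EFinP; apply: (measurableT_comp (@measurable_powR R p)).
  by apply: measurableT_comp => //; apply: measurable_funB => //; exact: measurable_cst.
have m2 : measurable_fun [set: T] (fun w => (t `^ p * V w)%:E).
  by apply/measurable_EFinP; apply: measurable_funM => //; exact: measurable_cst.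
have n1 w : (0 <= (`|g (S w) - m| `^ p)%:E)%E by rewrite lee_fin powR_ge0.
have n2 w : (0 <= (t `^ p * V w)%:E)%E by rewrite lee_fin mulr_ge0 ?powR_ge0.
have n3 : (0 <= ((t * expR 2) `^ p)%:E)%E by rewrite lee_fin powR_ge0.
rewrite ge0_integralZl_EFin ?powR_ge0//; first last.
- by apply: emeasurable_funD => //; apply: emeasurable_funD.
- by move=> w _; rewrite !adde_ge0.
rewrite ge0_integralD//; first last.
- exact: emeasurable_funD.
- by move=> w _; rewrite adde_ge0.
rewrite ge0_integralD// integral_cst// [X in (_ + _ * X)%E](@probability_setT _ _ _ P) mule1.
apply: (@le_trans _ _ (K%:E * ((Q `^ p * (2 * expR p))%:E + (t `^ p * expR 2)%:E +
    ((t * expR 2) `^ p)%:E))%E).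
  apply: lee_wpmul2l; first by rewrite lee_fin powR_ge0.
  by apply: leeD => //; apply: leeD => //; exact: scaleV (powR_ge0 _ _).
rewrite -!EFinD -EFinM lee_fin /K.
have e60 : 0 <= 6 * expR 2 :> R by rewrite mulr_ge0 ?expR_ge0.
rewrite (powRM _ (ltW t0) (expR_ge0 2)) (powRM _ e60 (ltW Q0)).
rewrite (@powRM _ 6) ?expR_ge0// (_ : 6 = 3 * 2 :> R); last by ring.
rewrite (@powRM _ 3)// -!mulrA ler_wpM2l ?powR_ge0//.
have tpQ : t `^ p <= Q `^ p by apply: ge0_ler_powR; rewrite ?nnegrE // ?(ltW p0) ?(ltW t0) ?(ltW Q0).
have two : 4 <= 2 `^ p :> R.
  by apply: (@le_trans _ _ (2 `^ 2)); [rewrite powR_mulrn//; lra|apply: ler_powR; lra].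
rewrite -expRM.
have e1 : expR p <= expR (2 * p) by rewrite ler_expR; lra.
have e2 : expR 2 <= expR (2 * p) by rewrite ler_expR; lra.
set E := expR (2 * p) in e1 e2 *; have E0 : 0 <= E by exact: expR_ge0.
set q := Q `^ p in tpQ *; have q0 : 0 <= q by exact: powR_ge0.
have tp0 : 0 <= t `^ p by exact: powR_ge0.
apply: (@le_trans _ _ (4 * (E * q))); last by rewrite ler_wpM2r// mulr_ge0.
have h1 : q * (2 * expR p) <= 2 * (E * q) by have := ler_wpM2l q0 e1; lra.
have h2 : t `^ p * expR 2 <= E * q by rewrite mulrC ler_pM// expR_ge0.
have h3 : t `^ p * E <= E * q by rewrite mulrC ler_wpM2l.
lra.
Qed.

End moment_inequality.

(** * Choice of the parameter *)

Section coefficients.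
Context {R : realType}.

(** Here e^{p/c} = p^{1/4}.  Since ln p = 2 ln (sqrt p) <= 2 sqrt p, its square
    sqrt p is at most 2 p / ln p. *)
Lemma sqrt_expR_le_div_ln (p : R) (c := 4 * (p / ln p)) : 2 <= p ->
  1 <= c /\ Num.sqrt c * expR (p / c) <= 4 * (p / ln p).
Proof.
move=> p2; have p0 : 0 < p by exact: lt_le_trans p2.
have lnp0 : 0 < ln p by rewrite ln_gt0//; lra.
have lnp : ln p <= p.
  apply: (@le_trans _ _ (p - 1)); last by rewrite lerBlDr lerDl.
  have := @le_ln1Dx _ (p - 1); rewrite (_ : 1 + (p - 1) = p); last by ring.
  by apply; lra.
pose r := p / ln p; have r0 : 0 < r by exact: divr_gt0.
have r1 : 1 <= r by rewrite /r ler_pdivlMr// mul1r.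
split; first by rewrite /c -/r; lra.
have pcE : p / c = ln p / 4 by rewrite /c; field; rewrite !gt_eqF.
have h : expR (p / c) ^+ 2 <= 2 * r.
  have -> : expR (p / c) ^+ 2 = expR (ln p / 2).
    by rewrite pcE expr2 -expRD; congr expR; field.
  set u := expR (ln p / 2).
  have uu : u * u = p by rewrite /u -expRD -splitr lnK.
  have lu : ln p <= 2 * u by have := expR_ge1Dx (ln p / 2); rewrite -/u; lra.
  have u0 : 0 <= u by exact: expR_ge0.
  rewrite /r mulrA ler_pdivlMr// -[in leRHS]uu.
  by have := ler_wpM2l u0 lu; lra.
have r4 : 0 <= 4 * r by rewrite mulr_ge0// ltW.
rewrite -/r -ler_sqr ?nnegrE ?r4 ?mulr_ge0 ?sqrtr_ge0 ?expR_ge0//.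
rewrite exprMn sqr_sqrtr; last by rewrite /c -/r mulr_ge0// ltW.
rewrite /c -/r; apply: le_trans (ler_wpM2l _ h) _; first by rewrite mulr_ge0// ltW.
by have := sqr_ge0 r; lra.
Qed.

(** The upper bound on alpha says that e^{p/alpha} >= e p, and alpha <= p; so the
    factor e^{p/(2 alpha)}, the square root of e^{p/alpha}, absorbs
    sqrt (2 alpha) up to a constant. *)
Lemma sqrt_expR_le_expR (p alpha : R) (c := 2 * alpha) : 2 <= p ->
  1 <= alpha -> alpha <= p / ln (expR 1 * p) ->
  Num.sqrt c * expR (p / c) <= 2 * expR (p / alpha).
Proof.
move=> p2 a1 ap; have p0 : 0 < p by exact: lt_le_trans p2.
have a0 : 0 < alpha by exact: lt_le_trans a1.
have lnE : ln (expR 1 * p) = 1 + ln p by rewrite lnM ?posrE ?expR_gt0// expRK.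
have lnp0 : 0 <= ln p by rewrite ln_ge0//; lra.
move: ap; rewrite lnE ler_pdivlMr; last by lra.
move=> ap.
have pa : p <= expR (p / alpha).
  rewrite -[leLHS]lnK ?posrE// ler_expR ler_pdivlMr// mulrC.
  by apply: le_trans ap; rewrite ler_wpM2l ?(ltW a0)//; lra.
have alp : alpha <= p by apply: le_trans ap; rewrite ler_peMr ?(ltW a0)//; lra.
have -> : expR (p / alpha) = expR (p / c) * expR (p / c).
  by rewrite -expRD; congr expR; rewrite /c; field; rewrite gt_eqF.
rewrite mulrA ler_wpM2r ?expR_ge0//.
rewrite -ler_sqr ?nnegrE ?mulr_ge0 ?sqrtr_ge0 ?expR_ge0//.
rewrite sqr_sqrtr ?mulr_ge0 ?(ltW a0)// exprMn [X in _ * X]expr2.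
rewrite -expRD (_ : p / c + p / c = p / alpha); first by rewrite /c; lra.
by rewrite /c; field; rewrite gt_eqF.
Qed.

End coefficients.

(** * The inequality for the extended real norms *)

Section norms.
Context {R : realType} {X : completeNormedModType R}.
Hypothesis sepX : separable X.
Context d (T : measurableType d) (P : probability T R).
Variable f : nat -> T -> X.
Hypothesis Mf : M_ind P f.

Let D j := increment f j.+1.

Lemma measurable_increment j : measurable_fun [set: T] (D j : T -> borel X).
Proof.
case: Mf => bf _ _; have mf k : measurable_fun [set: T] (f k : T -> borel X).
  by case: (bf k).
apply: measurable_borelD => //; exact: measurable_borelN.
Qed.

Lemma sum_increments n w : f n w = \sum_(j < n) D j w.
Proof.
case: Mf => _ f0 _; elim: n => [|n IH]; first by rewrite big_ord0 f0.
by rewrite big_ord_recr /= -IH addrC subrK.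
Qed.

Lemma norm_increment_le_dstar j w : ((`|D j w|)%:E <= dstar f w)%E.
Proof. by apply: ereal_sup_ubound; exists j.+1. Qed.

Lemma dstar_ge0 w : (0 <= dstar f w)%E.
Proof. exact: le_trans (norm_increment_le_dstar 0 w). Qed.

Lemma sum_sqr_le_S2 n w :
  (\sum_(j < n) (`|D j w| ^+ 2)%:E <= `|S2 f w| `^ 2)%E.
Proof.
have s0 : (0 <= \sum_(1 <= j <oo) (`|increment f j w| ^+ 2)%:E)%E.
  by apply: nneseries_ge0 => j _ _; rewrite lee_fin sqr_ge0.
rewrite gee0_abs ?poweR_ge0// /S2 -poweRrM mulVf// poweRe1//.
apply: le_trans (@nneseries_lim_ge _ _ xpredT 1 n.+1 _); last first.
  by move=> j _ _; rewrite lee_fin sqr_ge0.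
by rewrite big_add1 big_mkord.
Qed.

Lemma sum_sqr_le_Lnorm_S2 n (s : R) : 'N[P]_2%:E[S2 f]%E = s%:E ->
  (\sum_(j < n) \int[P]_w (`|D j w| ^+ 2)%:E <= (s ^+ 2)%:E)%E.
Proof.
move=> sE; have s0 : 0 <= s by rewrite -lee_fin -sE Lnorm_ge0.
have -> : (s ^+ 2)%:E = (\int[P]_w (`|S2 f w| `^ 2))%E.
  by rewrite -poweR_Lnorm// sE poweR_EFin powR_mulrn.
rewrite -ge0_integral_sum//; first last.
- move=> j; apply/measurable_EFinP; apply: measurable_funX.
  exact: (measurableT_comp measurable_norm_borel (measurable_increment j)).
apply: le_integral_ge0 => w; last exact: sum_sqr_le_S2.
by apply: sume_ge0 => j _; rewrite lee_fin sqr_ge0.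
Qed.

(** The truncation level must be positive even if d^* vanishes, so it is taken
    slightly above twice the norm of d^* and the slack tends to zero.  If a norm
    on the right is infinite, so is the right-hand side, its coefficient being
    positive. *)
Lemma centered_norm_le (p c : R) (x : X) (n : nat) : 2 <= p -> 1 <= c ->
  ('N[P]_p%:E[centered_norm P (fun w => (f n w + x)%R)] <=
   (12 * expR 2)%:E * (c%:E * 'N[P]_p%:E[dstar f] +
     (Num.sqrt c * expR (p / c))%:E * 'N[P]_2%:E[S2 f]))%E.
Proof.
move=> p2 c1; have p0 : 0 < p by exact: lt_le_trans p2.
have c0 : 0 < c by exact: lt_le_trans c1.
have v0 : 0 < Num.sqrt c * expR (p / c) by rewrite mulr_gt0 ?expR_gt0// sqrtr_gt0.
have e0 : 0 < 12 * expR 2 :> R by rewrite mulr_gt0 ?expR_gt0.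
have := Lnorm_ge0 P p%:E (dstar f); have := Lnorm_ge0 P 2%:E (S2 f).
case sE : ('N[P]_2%:E[S2 f])%E => [s| |]//; last first.
  move=> _ D0; rewrite [X in (_ + X)%E]gt0_muley ?lte_fin// addey; last first.
    by rewrite -ltNye (lt_le_trans (ltNyr 0))// mule_ge0// lee_fin ltW.
  by rewrite gt0_muley ?lte_fin// leey.
case DE : ('N[P]_p%:E[dstar f])%E => [dl| |]//; last first.
  by move=> s0 _; rewrite gt0_muley ?lte_fin// -EFinM addye// gt0_muley ?lte_fin// leey.
rewrite !lee_fin => s0 d0.
apply/lee_addgt0Pr => e egt0.
(* The slack is scaled so as to contribute exactly [e] to the final bound. *)
pose t := 2 * dl + e / (6 * expR 2 * c).
have k0 : 0 < 6 * expR 2 * c by rewrite !mulr_gt0 ?expR_gt0.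
have t0 : 0 < t by rewrite ltr_wpDl ?mulr_ge0// divr_gt0.
case: Mf => _ _ indD.
pose M w := (`|dstar f w| `^ p)%E.
have ME w : M w = (dstar f w `^ p)%E by rewrite /M gee0_abs// dstar_ge0.
have DM j w : (j < n)%N -> ((`|D j w| `^ p)%:E <= M w)%E.
  move=> _; rewrite ME -poweR_EFin; apply: gt0_ler_poweR.
  - exact: ltW.
  - by rewrite in_itv/= lee_fin normr_ge0 leey.
  - by rewrite in_itv/= dstar_ge0 leey.
  - exact: norm_increment_le_dstar.
have Mt : (\int[P]_w M w <= ((t / 2) `^ p)%:E)%E.
  rewrite -poweR_Lnorm ?gt_eqF// DE poweR_EFin lee_fin.
  have dt : dl <= t / 2.
    by rewrite ler_pdivlMr// mulrC /t lerDl divr_ge0// ltW.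
  by apply: ge0_ler_powR; rewrite ?nnegrE ?(ltW p0) ?divr_ge0 ?(ltW t0).
have [iZ hZ] := moment_inequality sepX measurable_increment indD x t0 p2 c1 s0
  DM (fun w => poweR_ge0 _ _) Mt (sum_sqr_le_Lnorm_S2 n sE).
set Q := c * t + Num.sqrt c * expR (p / c) * s in hZ.
have Q0 : 0 <= Q by rewrite /Q addr_ge0 ?mulr_ge0 ?(ltW c0) ?(ltW t0) ?(ltW v0) ?sqrtr_ge0 ?expR_ge0.
have fE w : `|f n w + x| = `|\sum_(j < n) D j w + x| by rewrite sum_increments.
have cE w : centered_norm P (fun w => f n w + x) w =
    (`|\sum_(j < n) D j w + x| - \int[P]_v `|\sum_(j < n) D j v + x|)%:E.
  rewrite /centered_norm unlock EFinB fE EFin_Rintegral//; congr (_ - _)%E.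
  by apply: eq_integral => v _; rewrite fE.
apply: (@le_trans _ _ (6 * expR 2 * Q)%:E).
  rewrite unlock.
  rewrite [X in (X `^ _)%E](_ : _ = \int[P]_w (`|(`|\sum_(j < n) D j w + x| -
      \int[P]_v `|\sum_(j < n) D j v + x|)%R| `^ p)%:E)%E; last first.
    by apply: eq_integral => w _; rewrite cE.
  have -> : 6 * expR 2 * Q = ((6 * expR 2 * Q) `^ p) `^ p^-1.
    by rewrite -powRrM mulfV ?gt_eqF// powRr1// mulr_ge0// mulr_ge0 ?expR_ge0.
  rewrite -poweR_EFin; apply: gt0_ler_poweR => //.
  - by rewrite invr_ge0 ltW.
  - rewrite in_itv/= leey andbT; apply: integral_ge0 => w _.
    by rewrite lee_fin powR_ge0.
  - by rewrite in_itv/= leey andbT lee_fin powR_ge0.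
rewrite -?EFinM -?EFinD -?EFinM -?EFinD lee_fin /Q /t.
set v := Num.sqrt c * expR (p / c).
have -> : 6 * expR 2 * (c * (2 * dl + e / (6 * expR 2 * c)) + v * s) =
    12 * expR 2 * (c * dl) + 6 * expR 2 * (v * s) + e.
  by field; rewrite !gt_eqF ?expR_gt0.
rewrite lerD2r [leRHS]mulrDr lerD2l ler_wpM2r ?mulr_ge0 ?(ltW v0)//.
by rewrite ler_wpM2r ?expR_ge0//; lra.
Qed.

End norms.
Lemma weaken_coefficients {R : realType} (L x y : \bar R) (A0 K c v a b : R) :
  0 <= A0 -> 0 <= K -> 0 <= a -> 0 <= b -> c <= K * a -> v <= K * b ->
  (0 <= x)%E -> (0 <= y)%E ->
  (L <= A0%:E * (c%:E * x + v%:E * y))%E ->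
  (L <= (A0 * K)%:E * (a%:E * x + b%:E * y))%E.
Proof.
move=> A00 K0 a0 b0 ca vb x0 y0 /le_trans; apply.
rewrite EFinM -muleA; apply: lee_wpmul2l; first by rewrite lee_fin.
rewrite ge0_muleDr ?mule_ge0 ?lee_fin// !muleA -!EFinM.
by apply: leeD; apply: lee_wpmul2r; rewrite ?lee_fin.
Qed.

Theorem theorem5p1 (R : realType) :
  exists A : R, 0 < A /\
    forall (X : completeNormedModType R), separable X ->
    forall (d : measure_display) (T : measurableType d) (P : probability T R)
      (f : nat -> T -> X), M_ind P f ->
    forall (p : R), 2 <= p ->
    forall (x : X) (n : nat), (1 <= n)%N ->
    let lhs := ('N[P]_p%:E[centered_norm P (fun w => (f n w + x)%R)])%E in
    [/\ forall c : R, 1 <= c <= p ->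
          (lhs <= A%:E * (c%:E * 'N[P]_p%:E[dstar f]
                   + (Num.sqrt c * expR (p / c))%:E * 'N[P]_2%:E[S2 f]))%E,
        (lhs <= A%:E * (p%:E * 'N[P]_p%:E[dstar f]
                 + (Num.sqrt p)%:E * 'N[P]_2%:E[S2 f]))%E,
        (lhs <= A%:E * (p / ln p)%:E
                 * ('N[P]_p%:E[dstar f] + 'N[P]_2%:E[S2 f]))%E
      & forall alpha : R, 1 <= alpha <= p / ln (expR 1 * p) ->
          (lhs <= A%:E * (alpha%:E * 'N[P]_p%:E[dstar f]
                   + (expR (p / alpha))%:E * 'N[P]_2%:E[S2 f]))%E].
Proof.
have e0 : 0 < expR 1 :> R by exact: expR_gt0.
have e1 : 1 <= expR 1 :> R by have := expR_ge1Dx (1 : R); lra.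
pose A0 : R := 12 * expR 2.
have A00 : 0 < A0 by rewrite /A0 mulr_gt0 ?expR_gt0.
(* The factor 4 serves the choices c = 4 p / ln p and c = 2 alpha, and expR 1
   the choice c = p, where e^{p/c} = e. *)
exists (A0 * (4 * expR 1)); split; first by rewrite !mulr_gt0.
move=> X sepX d T P f Mf p p2 x n _ lhs.
have p0 : 0 < p by exact: lt_le_trans p2.
have D0 := Lnorm_ge0 P p%:E (dstar f); have S0 := Lnorm_ge0 P 2%:E (S2 f).
have core c a b : 1 <= c -> 0 <= a -> 0 <= b -> c <= 4 * expR 1 * a ->
    Num.sqrt c * expR (p / c) <= 4 * expR 1 * b ->
    (lhs <= (A0 * (4 * expR 1))%:E * (a%:E * 'N[P]_p%:E[dstar f]
       + b%:E * 'N[P]_2%:E[S2 f]))%E.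
  move=> c1 a0 b0 ca cb; have := centered_norm_le sepX Mf x n p2 c1.
  by apply: weaken_coefficients; rewrite ?(ltW A00) ?mulr_ge0 ?(ltW e0).
have le4 (y z : R) : 0 <= z -> y <= 4 * z -> y <= 4 * expR 1 * z.
  move=> z0 /le_trans; apply; rewrite ler_wpM2r//; lra.
split.
- move=> c /andP[c1 _]; have c0 : 0 <= c by lra.
  have v0 : 0 <= Num.sqrt c * expR (p / c) by rewrite mulr_ge0 ?sqrtr_ge0 ?expR_ge0.
  by apply: (core c) => //; apply: le4 => //; lra.
- apply: (core p) => //; rewrite ?sqrtr_ge0//; try lra.
    by apply: le4; lra.
  rewrite divff ?gt_eqF// [leLHS]mulrC ler_wpM2r ?sqrtr_ge0//; lra.
- have [c1 hc] := sqrt_expR_le_div_ln p2.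
  have r0 : 0 <= p / ln p by rewrite divr_ge0 ?(ltW p0)// ln_ge0//; lra.
  rewrite -muleA ge0_muleDr//.
  by apply: (core (4 * (p / ln p))) => //; apply: le4.
- move=> alpha /andP[a1 ap].
  have hc := sqrt_expR_le_expR p2 a1 ap.
  have v0 : 0 <= expR (p / alpha) by exact: expR_ge0.
  apply: (core (2 * alpha)) => //; try lra.
    by apply: le4; lra.
  by apply: le4 => //; lra.
Qed.
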